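(* (A) Let $t\in\mathcal{S}'(\mathbb{R}^N)$ satisfy $t(q)=O^{\mathrm{dist}}(|q|^\delta)$ for some $\delta\in\mathbb{R}$. Then for every $g\in\mathcal{S}(\mathbb{R}^N)$, $$\int \frac{\mathrm{d}^N q}{(2\pi)^N}\, t(q)\, g_\epsilon(q) = O(\epsilon^\delta)\quad\text{as } \epsilon\searrow 0,$$ where $g_\epsilon(q):=\epsilon^{-N}g(q/\epsilon)$. (B) Let $t\in\mathcal{S}'(\mathbb{R}^N)$ be such that $t(q)=c+O^{\mathrm{dist}}(|q|^\delta)$ (i.e. $t-c=O^{\mathrm{dist}}(|q|^\delta)$) for some $\delta>0$ and $c\in\mathbb{C}$. Then $t$ has the value $t(0)=c$ at zero in the sense of Łojasiewicz. (C) Let $t\in\mathcal{S}'(\mathbb{R}^N)$ satisfy $t(q)=O^{\mathrm{dist}}(|q|^\delta)$, where $\delta\in\mathbb{R}$ and $\omega\in\mathbb{N}_+$ are such that $\delta+1>\omega$. Then $t$ has a zero of order $\omega$ at the origin in the sense of Łojasiewicz.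
   Context: Generalized big-O for distributions: for $t\in\mathcal{S}'(\mathbb{R}^N\times\mathbb{R}^M)$ and $\delta\in\mathbb{R}$ one writes $t(q,q')=O^{\mathrm{dist}}(|q|^\delta)$ ($q\in\mathbb{R}^N$, $q'\in\mathbb{R}^M$) iff there exist a neighborhood $\mathcal{O}$ of the origin in $\mathbb{R}^N\times\mathbb{R}^M$ and continuous functions $t_\alpha\in C(\mathcal{O})$, indexed by multi-indices $\alpha\in\mathbb{N}_0^N$, such that: (1) $t_\alpha\equiv 0$ for all but finitely many $\alpha$; (2) $t_\alpha\equiv0$ whenever $\delta+|\alpha|<0$; (3) $|t_\alpha(q,q')|\le \mathrm{const}\,|q|^{\delta+|\alpha|}$ on $\mathcal{O}$; (4) $t=\sum_\alpha \partial_q^\alpha t_\alpha$ as distributions on $\mathcal{O}$. Here $M=0$ is allowed (then $t(q)=O^{\mathrm{dist}}(|q|^\delta)$ for $t\in\mathcal{S}'(\mathbb{R}^N)$). Value in the sense of Łojasiewicz: $t\in\mathcal{S}'(\mathbb{R}^N)$ has value $t(0)\in\mathbb{C}$ at zero iff $\lim_{\epsilon\searrow0}\int\frac{\mathrm{d}^Nq}{(2\pi)^N}t(q)g_\epsilon(q)$ exists and equals $t(0)$ for every $g\in\mathcal{S}(\mathbb{R}^N)$ with $\int\frac{\mathrm{d}^Nq}{(2\pi)^N}g(q)=1$, where $g_\epsilon(q)=\epsilon^{-N}g(q/\epsilon)$. The distribution $t$ has a zero of order $\omega\in\mathbb{N}_+$ at the origin in the sense of Łojasiewicz iff for every multi-index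 $\gamma$ with $|\gamma|<\omega$ the distribution $\partial_q^\gamma t$ has value $0$ at zero in the sense of Łojasiewicz. *)

(* Defs.v *)
From HB Require Import structures.
From mathcomp Require Import all_boot all_order all_algebra.
From mathcomp Require Import all_classical all_reals all_analysis.
From mathcomp Require Import complex.
Set Implicit Arguments.
Unset Strict Implicit.
Unset Printing Implicit Defensive.
Import Order.TTheory GRing.Theory Num.Theory.
Import numFieldNormedType.Exports.
Local Open Scope classical_set_scope.
Local Open Scope ring_scope.
Local Open Scope complex_scope.

Fixpoint intR (R : realType) (n : nat) : ('rV[R]_n -> R) -> R :=
  match n with
  | 0 => fun f => f 0
  | n'.+1 => fun f =>
      Rintegral (@lebesgue_measure R) setT
        (fun x : R => @intR R n' (fun y : 'rV[R]_n' => f (row_mx (x%:M) y)))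
  end.

Notation normc := ComplexField.Normc.normc.

Section Distributions.
Variables (R : realType) (N : nat).

Definition fn := 'rV[R]_N -> R[i].
(* a (candidate) distribution: its pairing <t, phi> with test functions *)
Definition distr := fn -> R[i].
Definition multi_index := {ffun 'I_N -> nat}.
Definition mi_abs (a : multi_index) : nat := (\sum_i a i)%N.

Definition unit_vec (i : 'I_N) : 'rV[R]_N := delta_mx 0 i.
Definition cRe (f : fn) : 'rV[R]_N -> R := fun x => complex.Re (f x).
Definition cIm (f : fn) : 'rV[R]_N -> R := fun x => complex.Im (f x).

Definition partial (i : 'I_N) (f : fn) : fn := fun x =>
  ('D_(unit_vec i) (cRe f) x) +i* ('D_(unit_vec i) (cIm f) x).
Definition partial_exists (i : 'I_N) (f : fn) (x : 'rV[R]_N) :=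
  derivable (cRe f) x (unit_vec i) /\ derivable (cIm f) x (unit_vec i).
Definition ccont_at (f : fn) (x : 'rV[R]_N) :=
  {for x, continuous (cRe f)} /\ {for x, continuous (cIm f)}.

Fixpoint iter_partial (s : seq 'I_N) (f : fn) : fn :=
  match s with [::] => f | i :: s' => partial i (iter_partial s' f) end.

Definition smooth (f : fn) := forall (s : seq 'I_N) (x : 'rV[R]_N),
  ccont_at (iter_partial s f) x /\ forall i, partial_exists i (iter_partial s f) x.

Definition dpow (a : multi_index) (f : fn) : fn :=
  foldr (fun i g => iter (a i) (partial i) g) f (enum 'I_N).
Definition monomial (b : multi_index) (x : 'rV[R]_N) : R :=
  \prod_i (x 0 i) ^+ (b i).
Definition enorm (x : 'rV[R]_N) : R := Num.sqrt (\sum_i (x 0 i) ^+ 2).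

Definition schwartz (f : fn) := smooth f /\
  forall a b : multi_index, exists M : R, forall x,
    normc ((monomial b x)%:C * dpow a f x) <= M.

(* tempered distributions: C-linear functionals on S(R^N), continuous for
   the Schwartz topology (bounded by a finite max of seminorms) *)
Definition tempered (T : distr) :=
  (forall (c : R[i]) (f g : fn), schwartz f -> schwartz g ->
      T (fun x => c * f x + g x) = c * T f + T g) /\
  exists (K : R) (k : nat), forall f, schwartz f -> forall M : R,
    (forall a b : multi_index, (mi_abs a <= k)%N -> (mi_abs b <= k)%N ->
       forall x, normc ((monomial b x)%:C * dpow a f x) <= M) ->
    normc (T f) <= K * M.

Definition intC (f : fn) : R[i] := (intR (cRe f)) +i* (intR (cIm f)).
Definition nint (f : fn) : R[i] := intC f / ((2 * pi) ^+ N)%:C.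

Definition test_on (O : set 'rV[R]_N) (phi : fn) :=
  smooth phi /\ exists K : set 'rV[R]_N,
    [/\ compact K, K `<=` O & forall x, ~ K x -> phi x = 0].

Definition Odist (T : distr) (delta : R) :=
  exists O : set 'rV[R]_N, [/\ open O, O 0 &
  exists (ta : multi_index -> fn) (A : seq multi_index),
  uniq A /\
      (forall a, a \notin A -> forall q, O q -> ta a q = 0) /\
      (forall a, delta + (mi_abs a)%:R < 0 -> forall q, O q -> ta a q = 0) /\
      (forall a q, O q -> ccont_at (ta a) q) /\
      (forall a, exists c : R, forall q, O q ->
          normc (ta a q) <= c * (enorm q) `^ (delta + (mi_abs a)%:R)) /\
      (* (4) t = sum_alpha d^alpha t_alpha as distributions on O *)
      (forall phi, test_on O phi ->
         T phi = \sum_(a <- A) ((-1) ^+ mi_abs a * nint (fun q => ta a q * dpow a phi q)))].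

Definition scale (g : fn) (e : R) : fn := fun q => (e ^- N)%:C * g (e^-1 *: q).

Definition minus_const (T : distr) (c : R[i]) : distr := fun phi => T phi - c * nint phi.

Definition dist_deriv (g : multi_index) (T : distr) : distr :=
  fun phi => (-1) ^+ mi_abs g * T (dpow g phi).

Definition has_value_at0 (T : distr) (c : R[i]) :=
  forall g, schwartz g -> nint g = 1 ->
    forall eps : R, 0 < eps -> exists d : R, 0 < d /\
      forall e : R, 0 < e < d -> normc (T (scale g e) - c) < eps.

Definition zero_of_order (T : distr) (w : nat) :=
  forall g : multi_index, (mi_abs g < w)%N -> has_value_at0 (dist_deriv g T) 0.

End Distributions.

(* Main.v *)
Require Import Defs.
From HB Require Import structures.
From mathcomp Require Import all_boot all_order all_algebra.
From mathcomp Require Import all_classical all_reals all_analysis.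
From mathcomp Require Import measurable_realfun complex ring lra zify.
Set Implicit Arguments.
Unset Strict Implicit.
Unset Printing Implicit Defensive.
Import Order.TTheory GRing.Theory Num.Theory.
Import numFieldNormedType.Exports.
Local Open Scope classical_set_scope.
Local Open Scope ring_scope.
Local Open Scope complex_scope.

(** Write W(p) for the product of the 1 + p_i^2; the Schwartz seminorms may be replaced
   by the suprema of W^k times iterated partial derivatives. Let chi be a smooth cutoff
   near 0 and split g(p) = chi(e p) g(p) + (1 - chi(e p)) g(p) before rescaling. The
   second summand lives where |p| is at least a multiple of 1/e, so each extra power of
   W gains a factor e^2: after rescaling its seminorms are O(e^delta) for every delta,
   and temperedness of T applies. The rescaled first summand is a test function on the
   neighbourhood where T is the sum of the derivatives of the t_a. Substituting q = e p
   in the a-th term, the bound on t_a gives e^(delta + |a|) times a power of W(p), the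
   |a| derivatives cost e^(-|a|), and what remains is dominated by the integrable
   function 1/W, uniformly in e. This proves (A). For (B) apply (A) to T - c, since the
   integral of g_e does not depend on e; for (C) note that the pairing of the gamma-th
   derivative of T with g_e is, up to sign, e^(-|gamma|) times the pairing of T with
   (D^gamma g)_e, which is O(e^(delta - |gamma|)). *)

(** * Directional derivatives and Clairaut's theorem *)
Section DirectionalDerivatives.
Variables (R : realType) (V : normedModType R).
Implicit Types (u v : V -> R) (x e : V).

(** Restriction to a line turns each differentiation rule below into a one-variable rule. *)
Lemma is_derive_line u x e d :
  is_derive x e u d <-> is_derive (0 : R) 1 (fun h : R => u (h *: e + x)) d.
Proof.
have E : 'D_e u x = 'D_1 (fun h : R => u (h *: e + x)) 0.
  rewrite /derive; set g1 := fun h => h^-1 *: _; set g2 := fun h => h^-1 *: _.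
  suff -> : g1 = g2 by [].
  by apply/funext => h; rewrite /g1 /g2 /= addr0 scale0r add0r [_%:A]mulr1.
split=> -[dv D]; split.
- exact: (derivable1P _ _ _).1 dv.
- by rewrite -E.
- exact: (derivable1P _ _ _).2 dv.
- by rewrite E.
Qed.

Lemma is_derive_comp1 (F : R -> R) u x e d D :
  is_derive x e u d -> is_derive (u x) 1 F D ->
  is_derive x e (F \o u) (D * d).
Proof.
move=> /is_derive_line du dF; apply/is_derive_line.
have dF' : is_derive ((fun h : R => u (h *: e + x)) 0) 1 F D.
  by rewrite scale0r add0r.
exact: (is_derive1_comp dF' du).
Qed.

Lemma is_derive_dilate u x e d (c : R) :
  is_derive (c *: x) e u d -> is_derive x e (fun y => u (c *: y)) (c * d).
Proof.
move=> /is_derive_line du; apply/is_derive_line.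
have dc : is_derive (0 : R) 1 ( *%R c) c.
  have := @is_deriveZ _ _ _ id c (0:R) 1 1 (is_derive_id _ _).
  by rewrite /GRing.scale/= mulr1.
have du' : is_derive (c * 0) 1 (fun h : R => u (h *: e + c *: x)) d.
  by rewrite mulr0.
have := is_derive1_comp du' dc; rewrite mulrC.
rewrite (_ : _ \o _ = fun h : R => u (c *: (h *: e + x))) //.
by apply/funext => h /=; rewrite scalerDr scalerA.
Qed.

End DirectionalDerivatives.

Lemma is_derive_along (R : realType) (V : normedModType R) (u : V -> R) x e t d :
  is_derive (t *: e + x) e u d -> is_derive t 1 (fun h : R => u (h *: e + x)) d.
Proof.
move=> /is_derive_line du.
(* [is_derive_line] is used here on the real line itself, to move the base point from 0 to [t]. *)
apply: (iffRL (@is_derive_line R R^o _ t 1 d)).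
rewrite (_ : (fun _ => _) = fun h : R => u (h *: e + (t *: e + x))) //.
by apply/funext => h; rewrite [h%:A]mulr1 scalerDl addrA.
Qed.

(** * Smooth real-valued functions on R^N and symmetry of mixed partials *)

Section RealPartials.
Variables (R : realType) (N : nat).
Implicit Types (u v : 'rV[R]_N -> R) (x : 'rV[R]_N) (i : 'I_N) (s : seq 'I_N).

(** Real counterparts of [partial], [iter_partial] and [smooth]: complex functions are handled
    through their real and imaginary parts, so all calculus is real. *)
Definition rpartial i u := fun x => 'D_(unit_vec R i) u x.
Definition riter s u := foldr rpartial u s.
Definition rdiff u := forall x, {for x, continuous u} /\
  forall i, derivable u x (unit_vec R i).
Definition rsmooth u := forall s, rdiff (riter s u).

Lemma riter_rcons s i u : riter (rcons s i) u = riter s (rpartial i u).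
Proof. by rewrite /riter -cats1 foldr_cat. Qed.

Lemma riter_cat s t u : riter (s ++ t) u = riter s (riter t u).
Proof. by rewrite /riter foldr_cat. Qed.

Lemma rsmooth_riter s u : rsmooth u -> rsmooth (riter s u).
Proof. by move=> su t; rewrite -riter_cat. Qed.

Lemma rsmooth_rpartial i u : rsmooth u -> rsmooth (rpartial i u).
Proof. exact: (@rsmooth_riter [:: i]). Qed.

(** Smoothness is a greatest fixed point, so it can be proved by exhibiting a class stable under
    partials, without any formula for higher derivatives. *)
Lemma rsmooth_coind (P : ('rV[R]_N -> R) -> Prop) :
  (forall u, P u -> rdiff u /\ forall i, P (rpartial i u)) ->
  forall u, P u -> rsmooth u.
Proof.
move=> H u Pu s.
suff /H[] : P (riter s u) by [].
by elim: s => //= i s /H[].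
Qed.

Lemma rsmooth_is_derive u i x : rsmooth u ->
  is_derive x (unit_vec R i) u (rpartial i u x).
Proof. by move=> su; apply: derivableP; have [_] := su [::] x. Qed.

Lemma rpartialE u i (d : 'rV[R]_N -> R) :
  (forall x, is_derive x (unit_vec R i) u (d x)) -> rpartial i u = d.
Proof. by move=> H; apply/funext => x; case: (H x). Qed.

Lemma rsmooth_continuous u : rsmooth u -> continuous u.
Proof. by move=> su x; have [] := su [::] x. Qed.

Lemma rdiff_is_derive u i x : rdiff u ->
  is_derive x (unit_vec R i) u (rpartial i u x).
Proof. by move=> /(_ x)[_ H]; exact: derivableP. Qed.

Lemma rdiffP u (d : 'I_N -> 'rV[R]_N -> R) : continuous u ->
  (forall i x, is_derive x (unit_vec R i) u (d i x)) -> rdiff u.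
Proof. by move=> cu H x; split => [|i]; [exact: cu|case: (H i x)]. Qed.

Lemma rpartialD u v i : rdiff u -> rdiff v ->
  rpartial i (fun x => u x + v x) = (fun x => rpartial i u x + rpartial i v x).
Proof. by move=> du dv; apply: rpartialE => x; apply: is_deriveD; exact: rdiff_is_derive. Qed.

Lemma rpartialM u v i : rdiff u -> rdiff v ->
  rpartial i (fun x => u x * v x) =
  (fun x => u x * rpartial i v x + v x * rpartial i u x).
Proof.
by move=> du dv; apply: rpartialE => x;
   apply: is_deriveM; exact: rdiff_is_derive.
Qed.

Lemma rdiffD u v : rdiff u -> rdiff v -> rdiff (fun x => u x + v x).
Proof.
move=> du dv; apply: (@rdiffP _ (fun i => rpartial i u \+ rpartial i v)) => [x|i x].
  by apply: continuousD; [have [] := du x|have [] := dv x].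
by apply: is_deriveD; exact: rdiff_is_derive.
Qed.

Lemma rdiffM u v : rdiff u -> rdiff v -> rdiff (fun x => u x * v x).
Proof.
move=> du dv.
apply: (@rdiffP _ (fun i x => u x * rpartial i v x + v x * rpartial i u x)) => [x|i x].
  by apply: continuousM; [have [] := du x|have [] := dv x].
by apply: is_deriveM; exact: rdiff_is_derive.
Qed.

(* [H] is a family of one-variable functions closed under differentiation. *)
Inductive smooth_alg (I : Type) (H : I -> R -> R) : ('rV[R]_N -> R) -> Prop :=
| Alg_smooth u : rsmooth u -> smooth_alg H u
| Alg_add u v : smooth_alg H u -> smooth_alg H v -> smooth_alg H (fun x => u x + v x)
| Alg_mul u v : smooth_alg H u -> smooth_alg H v -> smooth_alg H (fun x => u x * v x)
| Alg_comp k u : smooth_alg H u -> smooth_alg H (fun x => H k (u x)).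

(** The sum, product and chain rules keep the partials of a member inside the algebra, so
    coinduction applies. *)
Lemma smooth_alg_rsmooth (I : Type) (H : I -> R -> R) (D : I -> I) :
  (forall k (y : R), is_derive y 1 (H k) (H (D k) y)) ->
  forall u, smooth_alg H u -> rsmooth u.
Proof.
move=> HD; apply: rsmooth_coind => u; elim=> {u}.
- move=> u su; split; first exact: (su [::]).
  by move=> i; apply: Alg_smooth; exact: rsmooth_rpartial.
- move=> u v _ [du Pu] _ [dv Pv]; split; first exact: rdiffD.
  by move=> i; rewrite rpartialD//; apply: Alg_add.
- move=> u v Gu [du Pu] Gv [dv Pv]; split; first exact: rdiffM.
  by move=> i; rewrite rpartialM//; apply: Alg_add; apply: Alg_mul.
- move=> k u Gu [du Pu].
  have dH i x : is_derive x (unit_vec R i) (fun y => H k (u y))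
      (H (D k) (u x) * rpartial i u x).
    by apply: (is_derive_comp1 (rdiff_is_derive i x du)); exact: HD.
  split.
    apply: rdiffP dH => x; apply: continuous_comp; first by have [] := du x.
    by apply/differentiable_continuous/derivable1_diffP; case: (HD k (u x)).
  by move=> i; rewrite (rpartialE (dH i)); apply: Alg_mul => //; apply: Alg_comp.
Qed.

Lemma rsmooth_cst (c : R) : rsmooth (fun=> c).
Proof.
apply: (@rsmooth_coind (fun u => exists c, u = fun=> c)); last by exists c.
move=> _ [{}c ->].
have dc i x : is_derive x (unit_vec R i) (fun=> c) 0 by exact: is_derive_cst.
split; first by apply: rdiffP dc; exact: cst_continuous.
by move=> i; exists 0; apply: rpartialE.
Qed.

(** The one-element family containing the zero function is closed under differentiation; this
    instance isolates closure under sums and products. *)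
Let alg0 u := smooth_alg (fun (_ : unit) (_ : R) => 0 : R) u.
Let alg0_rsmooth u : alg0 u -> rsmooth u.
Proof.
by apply: (@smooth_alg_rsmooth _ _ id) => k y; exact: is_derive_cst.
Qed.

Lemma rsmoothD u v : rsmooth u -> rsmooth v -> rsmooth (fun x => u x + v x).
Proof. by move=> su sv; apply: alg0_rsmooth; apply: Alg_add; apply: Alg_smooth. Qed.

Lemma rsmoothM u v : rsmooth u -> rsmooth v -> rsmooth (fun x => u x * v x).
Proof. by move=> su sv; apply: alg0_rsmooth; apply: Alg_mul; apply: Alg_smooth. Qed.

Lemma rsmooth_coord i : rsmooth (fun x => x 0 i).
Proof.
have dc j x : is_derive x (unit_vec R j) (fun x => x 0 i) ((j == i)%:R).
  apply/is_derive_line.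
  rewrite (_ : (fun _ => _) = (fun h : R => (j == i)%:R * h + x 0 i)).
    rewrite -[X in is_derive _ _ _ X]addr0; apply: is_deriveD.
    have := @is_deriveZ _ _ _ id (j == i)%:R (0:R) 1 1 (is_derive_id _ _).
    by rewrite /GRing.scale/= mulr1.
  by apply/funext => h; rewrite !mxE eqxx eq_sym mulrC.
(* The last index of a list is differentiated first, and this first derivative is already
   constant. *)
move=> s; case/lastP: s => [|s j].
  by apply: rdiffP dc => x; exact: coord_continuous.
by rewrite riter_rcons (rpartialE (dc j)); exact: rsmooth_cst.
Qed.

Lemma rpartialZ c u i : rdiff u ->
  rpartial i (fun x => c * u x) = (fun x => c * rpartial i u x).
Proof.
by move=> du; apply: rpartialE => x; apply: (@is_deriveZ _ _ _ u); exact: rdiff_is_derive.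
Qed.

Lemma riterZ s c u : rsmooth u ->
  riter s (fun x => c * u x) = (fun x => c * riter s u x).
Proof. by move=> su; elim: s => //= i s ->; rewrite rpartialZ. Qed.

Lemma rsmoothZ c u : rsmooth u -> rsmooth (fun x => c * u x).
Proof. by move=> su; exact: (rsmoothM (rsmooth_cst c) su). Qed.

Lemma riterD s u v : rsmooth u -> rsmooth v ->
  riter s (fun x => u x + v x) = (fun x => riter s u x + riter s v x).
Proof. by move=> su sv; elim: s => //= i s ->; rewrite rpartialD. Qed.

Lemma is_derive_rdilate c u i x : rsmooth u ->
  is_derive x (unit_vec R i) (fun y => u (c *: y)) (c * rpartial i u (c *: x)).
Proof. by move=> su; apply: is_derive_dilate; exact: rsmooth_is_derive. Qed.

Lemma rpartial_dilate c u i : rsmooth u ->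
  rpartial i (fun x => u (c *: x)) = (fun x => c * rpartial i u (c *: x)).
Proof. by move=> su; apply: rpartialE => x; exact: is_derive_rdilate. Qed.

Lemma rsmooth_dilate c u : rsmooth u -> rsmooth (fun x => u (c *: x)).
Proof.
move=> su.
(* The scalar [a] collects the factors [c] that the chain rule produces. *)
apply: (@rsmooth_coind (fun w => exists a v, rsmooth v /\ w = fun x => a * v (c *: x))).
  move=> _ [a [v [sv ->]]].
  have dv i x : is_derive x (unit_vec R i) (fun y => a * v (c *: y))
      (a * (c * rpartial i v (c *: x))).
    by apply: (@is_deriveZ _ _ _ (fun y => v (c *: y))); exact: is_derive_rdilate.
  split.
    apply: rdiffP dv => x; apply: continuousM; first exact: cst_continuous.
    apply: continuous_comp; first exact: scaler_continuous.
    exact: rsmooth_continuous.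
  move=> i; exists (a * c), (rpartial i v); split; first exact: rsmooth_rpartial.
  by rewrite (rpartialE (dv i)); apply/funext => x; rewrite mulrA.
by exists 1, u; split=> //; apply/funext => x; rewrite mul1r.
Qed.

Lemma riter_dilate c u s : rsmooth u ->
  riter s (fun x => u (c *: x)) = (fun x => c ^+ size s * riter s u (c *: x)).
Proof.
move=> su; elim: s => [|i s /= ->]; first by apply/funext => x /=; rewrite mul1r.
have sr : rsmooth (riter s u) by exact: rsmooth_riter.
rewrite rpartialZ; last by exact: (rsmooth_dilate c sr [::]).
by rewrite rpartial_dilate//; apply/funext => x; rewrite exprSr mulrA.
Qed.

Lemma riter_local (O : set 'rV[R]_N) u v s : open O ->
  (forall x, O x -> u x = v x) -> forall x, O x -> riter s u x = riter s v x.
Proof.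
move=> oO uv; elim: s => [|i s IH] x Ox //=; first exact: uv.
by apply: near_eq_derive; apply: filterS (open_nbhs_nbhs (conj oO Ox)) => y /IH.
Qed.

Lemma riter_cst0 s : riter s (fun=> 0) = fun=> 0.
Proof.
have := @riterZ s 0 _ (@rsmooth_cst 0).
by rewrite mul0r => ->; apply/funext => x; rewrite mul0r.
Qed.

Lemma riter_eq0 (O : set 'rV[R]_N) u s : open O ->
  (forall x, O x -> u x = 0) -> forall x, O x -> riter s u x = 0.
Proof. by move=> oO u0 x Ox; rewrite (riter_local s oO u0 Ox) riter_cst0. Qed.

Lemma is_derive_shift_vec w (z x e : 'rV[R]_N) (d : R) :
  is_derive (x + z) e w d -> is_derive x e (fun y => w (y + z)) d.
Proof.
move=> /is_derive_line H; apply/is_derive_line; move: H.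
by congr is_derive; apply/funext => h; rewrite addrA.
Qed.

Lemma MVT_dir w (dw : 'rV[R]_N -> R) (x e : 'rV[R]_N) (h : R) : 0 < h ->
  (forall y, is_derive y e w (dw y)) ->
  exists2 t, 0 < t < h & w (h *: e + x) - w x = dw (t *: e + x) * h.
Proof.
move=> h0 dwE.
have H (t : R) : is_derive t 1 (fun s : R => w (s *: e + x)) (dw (t *: e + x)).
  exact: is_derive_along.
have [|t] := @MVT R (fun s : R => w (s *: e + x)) (fun s : R => dw (s *: e + x)) 0 h h0
  (fun t _ => H t).
  apply: continuous_subspaceT => t.
  by apply/differentiable_continuous/derivable1_diffP; case: (H t).
rewrite in_itv/= => th; rewrite scale0r add0r subr0 => E; by exists t.
Qed.

(** Two uses of the mean value theorem: along [a] for the increment of [u] by [h *: b], then along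
    [b] for the i-th partial. The left side is symmetric in the two directions, which is what
    Clairaut's theorem exploits. *)
Lemma second_difference u i j (x : 'rV[R]_N) (h : R) : rsmooth u -> 0 < h ->
  let a := unit_vec R i in let b := unit_vec R j in
  exists s t : R, [/\ 0 < s < h, 0 < t < h &
   u (h *: a + x + h *: b) - u (h *: a + x) - (u (x + h *: b) - u x) =
   rpartial j (rpartial i u) (t *: b + (s *: a + x)) * h * h].
Proof.
move=> su h0 a b.
have [s sh E1] := @MVT_dir (fun y => u (y + h *: b) - u y)
  (fun y => rpartial i u (y + h *: b) - rpartial i u y) x a h h0
  (fun y => is_deriveB (is_derive_shift_vec (rsmooth_is_derive i (y + h *: b) su))
                       (rsmooth_is_derive i y su)).
have [t th E2] := @MVT_dir (rpartial i u) (rpartial j (rpartial i u))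
   (s *: a + x) b h h0
  (fun y => rsmooth_is_derive j y (rsmooth_rpartial i su)).
exists s, t; split => //; rewrite -E2.
by rewrite E1 [s *: a + x + _]addrC.
Qed.

(** Both mixed partials, taken at suitable points of a small parallelogram at [x], equal the same
    second difference divided by h^2. Continuity at [x] makes their difference there smaller than
    any [eps]. *)
Lemma rpartialC u i j : rsmooth u ->
  rpartial i (rpartial j u) = rpartial j (rpartial i u).
Proof.
move=> su; apply/funext => x; apply/eqP; rewrite -subr_eq0 -normr_le0.
apply/ler_addgt0Pl => eps eps0; rewrite addr0.
set a := unit_vec R i; set b := unit_vec R j.
have e2 : 0 < eps / 2 by rewrite divr_gt0.
have cij : continuous (rpartial i (rpartial j u)).
  by apply: rsmooth_continuous; do 2! apply: rsmooth_rpartial.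
have cji : continuous (rpartial j (rpartial i u)).
  by apply: rsmooth_continuous; do 2! apply: rsmooth_rpartial.
have [/= r r0 Hr] : nbhs_ball x [set y |
    `|rpartial i (rpartial j u) x - rpartial i (rpartial j u) y| < eps / 2 /\
    `|rpartial j (rpartial i u) x - rpartial j (rpartial i u) y| < eps / 2].
  apply/nbhs_ballP; apply: filterI.
    by have /cvgrPdist_lt := cij x; exact.
  by have /cvgrPdist_lt := cji x; exact.
(* With [h := r / m] the parallelogram spanned at [x] stays in the ball of radius [r]; the summand 1
   makes [m] positive and the inclusion strict. *)
pose m := `|a| + `|b| + 1.
have m0 : 0 < m by rewrite ltr_wpDl// addr_ge0.
pose h := r / m.
have h0 : 0 < h by rewrite divr_gt0.
have near_x (s t : R) : 0 < s < h -> 0 < t < h -> ball x r (t *: b + (s *: a + x)).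
  move=> /andP[s0 sh] /andP[t0 th].
  rewrite -ball_normE /ball_/= addrA opprD addrCA subrr addr0 normrN.
  apply: le_lt_trans (ler_normD _ _) _; rewrite !normrZ !gtr0_norm//.
  apply: (@le_lt_trans _ _ (h * (`|a| + `|b|))).
    by rewrite mulrDr addrC lerD// ler_wpM2r// ltW.
  by rewrite /h mulrAC ltr_pdivrMr// ltr_pM2l// ltrDl.
have [s1 [t1 [sh1 th1 E1]]] := second_difference i j x su h0.
have [s2 [t2 [sh2 th2 E2]]] := second_difference j i x su h0.
have [_ H1] := Hr _ (near_x _ _ sh1 th1).
have H2 : ball x r (t2 *: a + (s2 *: b + x)) by rewrite addrCA; exact: near_x.
have [{}H2 _] := Hr _ H2.
have E : rpartial j (rpartial i u) (t1 *: b + (s1 *: a + x)) =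
         rpartial i (rpartial j u) (t2 *: a + (s2 *: b + x)).
  have hh : h != 0 by rewrite gt_eqF.
  apply: (mulIf hh); apply: (mulIf hh); apply: etrans (esym E1) (etrans _ E2).
  rewrite -/a -/b [h *: a + x]addrC [h *: b + x]addrC [x + h *: a + h *: b]addrAC.
  move: (u (x + h *: b + h *: a)) (u (x + h *: a)) (u (x + h *: b)) (u x) => p q r' s'.
  by ring.
rewrite E in H1; apply: ltW; rewrite distrC in H1.
by rewrite [eps]splitr (le_lt_trans (ler_distD _ _ _) (ltrD H2 H1)).
Qed.

Lemma riter_rpartial s u i : rsmooth u ->
  riter s (rpartial i u) = rpartial i (riter s u).
Proof.
move=> su; elim: s => [//|j s IH].
by rewrite -[LHS]/(rpartial j (riter s (rpartial i u))) IH (rpartialC _ _ (rsmooth_riter s su)).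
Qed.

(** By symmetry of mixed partials a list of indices acts only through its multiplicities, that is,
    as a multi-index. *)
Lemma riter_perm s t u : rsmooth u -> perm_eq s t -> riter s u = riter t u.
Proof.
move=> su; elim: s t => [|i s IH] t; first by rewrite perm_sym => /perm_nilP ->.
move=> st; have it : i \in t by rewrite -(perm_mem st) mem_head.
case/splitPr: t / it st => t1 t2 st.
have -> : riter (t1 ++ i :: t2) u = rpartial i (riter (t1 ++ t2) u).
  rewrite !riter_cat -[riter (i :: t2) u]/(rpartial i (riter t2 u)).
  by apply: riter_rpartial; exact: rsmooth_riter.
rewrite -[LHS]/(rpartial i (riter s u)) (IH (t1 ++ t2))//; move: st.
by rewrite -[i :: t2]cat1s perm_sym perm_catCA /= perm_cons perm_sym.
Qed.

(** A crude Leibniz estimate: each derivative at most doubles the number of products, and every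
    product is bounded by [A * B]. The induction peels off the innermost derivative. *)
Lemma riterM_le n (A B : R) u v (x : 'rV[R]_N) s : rsmooth u -> rsmooth v ->
  (forall s, (size s <= n)%N -> `|riter s u x| <= A) ->
  (forall s, (size s <= n)%N -> `|riter s v x| <= B) ->
  (size s <= n)%N ->
  `|riter s (fun y => u y * v y) x| <= 2 ^+ n * (A * B).
Proof.
elim: n A B u v s => [|n IH] A B u v s su sv uA vB.
  by case: s => // _; rewrite normrM mul1r ler_pM// (uA [::], vB [::]).
have A0 : 0 <= A by apply: le_trans (uA [::] _).
have B0 : 0 <= B by apply: le_trans (vB [::] _).
case/lastP: s => [_|s i].
  rewrite /= normrM; apply: (@le_trans _ _ (A * B)).
    by rewrite ler_pM// (uA [::], vB [::]).
  by rewrite ler_peMl ?mulr_ge0// exprn_ege1// ler1n.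
rewrite size_rcons ltnS => sn.
have dS w C : (forall s, (size s <= n.+1)%N -> `|riter s w x| <= C) ->
    forall s, (size s <= n)%N -> `|riter s (rpartial i w) x| <= C.
  by move=> H s' s'n; rewrite -riter_rcons H// size_rcons.
have wS w C : (forall s, (size s <= n.+1)%N -> `|riter s w x| <= C) ->
    forall s, (size s <= n)%N -> `|riter s w x| <= C.
  by move=> H s' s'n; rewrite H// ltnW.
have [su' sv'] := (rsmooth_rpartial i su, rsmooth_rpartial i sv).
rewrite riter_rcons (rpartialM i (su [::]) (sv [::])).
rewrite (riterD s (rsmoothM su sv') (rsmoothM sv su')).
apply: le_trans (ler_normD _ _) _.
rewrite exprS -mulrA mulr_natl mulr2n lerD//.
- by apply: IH => //; [exact: wS|exact: dS].
- by rewrite [A * B]mulrC; apply: IH => //; [exact: wS|exact: dS].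
Qed.
End RealPartials.

(** * Smooth cutoff functions *)
Section FlatFunctions.
Variable R : realType.
Implicit Types (p : {poly R}) (x y : R).

(* The classical flat functions p(1/x) e^(-1/x): with all polynomials p allowed, the
   family is closed under differentiation. *)
Definition flat p x : R := if 0 < x then p.[x^-1] * expR (- x^-1) else 0.
(** The derivative of p(1/x) e^(-1/x) is x^(-2) (p - p')(1/x) e^(-1/x), again a polynomial in 1/x
    times the exponential. *)
Definition flat_deriv p : {poly R} := 'X^2 * (p - p^`()).

(** Raise y/m <= 1 + y/m <= e^(y/m) to the m-th power; m = 0 relies on 0^0 = 1. *)
Lemma pow_expRN_le (m : nat) y : 0 <= y -> y ^+ m * expR (- y) <= m%:R ^+ m.
Proof.
case: m => [|m] y0; first by rewrite !expr0 mul1r expR_le1 oppr_le0.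
rewrite expRN ler_pdivrMr ?expR_gt0//.
have m0 : (m.+1%:R : R) != 0 by [].
rewrite {2}(_ : y = m.+1%:R * (y / m.+1%:R)); last by rewrite mulrC divfK.
rewrite mulrC expRM_natl -exprMn lerXn2r ?nnegrE ?mulr_ge0 ?expR_ge0//.
apply: (@le_trans _ _ (m.+1%:R * (y / m.+1%:R))); first by rewrite mulrC divfK.
rewrite mulrC ler_wpM2r//; apply: le_trans (expR_ge1Dx _).
by rewrite lerDr.
Qed.

Lemma horner_le_pow p : exists C, forall y, 1 <= y -> `|p.[y]| <= C * y ^+ size p.
Proof.
exists (\sum_(i < size p) `|p`_i|) => y y1.
rewrite horner_coef mulr_suml; apply: le_trans (ler_norm_sum _ _ _) _.
apply: ler_sum => i _; rewrite normrM normrX (ger0_norm (le_trans ler01 y1)).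
by rewrite ler_wpM2l// ler_weXn2l// ltnW.
Qed.

Lemma flat_quadratic p : exists C, forall x, `|x| <= 1 -> `|flat p x| <= C * x ^+ 2.
Proof.
have [C HC] := horner_le_pow p.
have C0 : 0 <= C.
  by have := HC 1 (lexx _); rewrite expr1n mulr1; apply: le_trans.
(* [size p] powers of 1/x pay for the polynomial; the other two become the factor x^2. *)
pose m := (size p).+2.
exists (C * m%:R ^+ m) => x x1; rewrite /flat; case: ltP => x0; last first.
  by rewrite normr0 mulr_ge0 ?sqr_ge0// mulr_ge0// exprn_ge0.
have y1 : 1 <= x^-1 by rewrite invf_ge1//; apply: le_trans x1; exact: ler_norm.
have y0 : 0 <= x^-1 by rewrite invr_ge0 ltW.
rewrite normrM (ger0_norm (expR_ge0 _)).
apply: (@le_trans _ _ (C * (x^-1 ^+ m * expR (- x^-1)) * x ^+ 2)); last first.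
  by rewrite ler_wpM2r ?sqr_ge0// ler_wpM2l// pow_expRN_le.
have -> : C * (x^-1 ^+ m * expR (- x^-1)) * x ^+ 2 = C * x^-1 ^+ size p * expR (- x^-1).
  by rewrite /m !exprS; field; rewrite gt_eqF.
by rewrite ler_wpM2r ?expR_ge0// HC.
Qed.

Lemma is_derive_flat p x : is_derive x 1 (flat p) (flat (flat_deriv p) x).
Proof.
have [x0|x0|<-] := ltgtP 0 x.
- rewrite {2}/flat x0.
  apply: (@near_eq_is_derive _ _ _ (fun x => p.[x^-1] * expR (- x^-1))).
    by near=> y; rewrite /flat ifT//; near: y; exact: lt_nbhsr.
  have xN0 : x != 0 by rewrite gt_eqF.
  have dV : is_derive x 1 (fun y : R => y^-1) (- x ^- 2).
    have := @is_deriveV R id x 1 1 xN0 (is_derive_id _ _).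
    by rewrite /GRing.scale/= mulr1.
  have dp : is_derive x 1 (fun y : R => p.[y^-1]) (p^`().[x^-1] * - x ^- 2).
    exact: (@is_derive1_comp _ (fun y => p.[y]) _ _ _ _ (is_derive_poly p x^-1) dV).
  have de : is_derive x 1 (fun y : R => expR (- y^-1)) (expR (- x^-1) * x ^- 2).
    have := is_deriveN dV; rewrite opprK => dN.
    exact: (@is_derive1_comp _ expR _ _ _ _ (is_derive_expR _) dN).
  rewrite [X in is_derive _ _ _ X](_ : _ = p.[x^-1] * (expR (- x^-1) * x ^- 2) +
      expR (- x^-1) * (p^`().[x^-1] * - x ^- 2)); first exact: is_deriveM.
  by rewrite /flat_deriv !hornerE/= exprVn; ring.
- rewrite {2}/flat ltNge (ltW x0)/=.
  apply: (@near_eq_is_derive _ _ _ (fun=> 0)).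
  by near=> y; rewrite /flat ltNge ifF//; apply/negbF/ltW; near: y; exact: lt_nbhsl.
(* At the origin the difference quotient is O(|h|) by [flat_quadratic], so it tends to 0, the value
   of every flat function there. *)
- rewrite {2}/flat ltxx.
  have [C HC] := flat_quadratic p.
  have H : (fun h : R => h^-1 *: ((flat p \o shift 0) (h *: 1) - flat p 0)) @ 0^' --> (0 : R).
    apply/cvgrPdist_le => e e0.
    have C1 : 0 < `|C| + 1 by rewrite ltr_wpDl.
    near=> h.
    have h0 : h != 0 by near: h; exact: nbhs_dnbhs_neq.
    have h1 : `|h| <= 1 by near: h; apply: dnbhs0_le.
    have he : `|h| <= e / (`|C| + 1) by near: h; apply: dnbhs0_le; rewrite divr_gt0.
    rewrite /= addr0 [_%:A]mulr1 {2}/flat ltxx subr0 sub0r normrN normrM normfV.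
    rewrite ler_pdivrMl ?normr_gt0//.
    apply: (le_trans (HC h h1)); rewrite -[h ^+ 2]ger0_norm ?sqr_ge0// normrX expr2.
    rewrite mulrA [leLHS]mulrC ler_wpM2l//.
    move: he; rewrite ler_pdivlMr// mulrC; apply: le_trans.
    by rewrite ler_wpM2r// (le_trans (ler_norm _))// lerDl.
  by split; [apply/cvg_ex; exists 0|exact/cvg_lim].
Unshelve. all: by end_near. Qed.

Lemma flat_ge0 x : 0 <= flat 1 x.
Proof. by rewrite /flat; case: ifP => // _; rewrite hornerE mul1r expR_ge0. Qed.

Lemma flat_gt0 x : 0 < x -> 0 < flat 1 x.
Proof. by move=> x0; rewrite /flat x0 hornerE mul1r expR_gt0. Qed.

Lemma flat_le0 p x : x <= 0 -> flat p x = 0.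
Proof. by move=> x0; rewrite /flat ltNge x0. Qed.

Lemma flat_homo x y : x <= y -> flat 1 x <= flat 1 y.
Proof.
move=> xy; have [x0|x0] := leP x 0; first by rewrite flat_le0// flat_ge0.
have y0 := lt_le_trans x0 xy.
by rewrite /flat x0 y0 !hornerE ler_expR lerN2 lef_pV2.
Qed.
End FlatFunctions.

Section Cutoff.
Variables (R : realType) (N : nat).

Definition sqnorm (x : 'rV[R]_N) : R := \sum_i x 0 i ^+ 2.

Lemma rsmooth_sum (I : Type) (l : seq I) (u : I -> 'rV[R]_N -> R) :
  (forall i, rsmooth (u i)) -> rsmooth (fun x => \sum_(i <- l) u i x).
Proof.
move=> su; elim: l => [|i l IH].
  by rewrite (_ : (fun _ => _) = fun=> 0); [exact: rsmooth_cst|apply/funext => x; rewrite big_nil].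
rewrite (_ : (fun _ => _) = fun x => u i x + \sum_(i <- l) u i x); first exact: (rsmoothD (su i) IH).
by apply/funext => x; rewrite big_cons.
Qed.

Lemma rsmooth_sqnorm : rsmooth sqnorm.
Proof.
by apply: rsmooth_sum => i; apply: rsmoothM; exact: rsmooth_coord.
Qed.

Lemma rsmooth_flat p (u : 'rV[R]_N -> R) : rsmooth u -> rsmooth (fun x => flat p (u x)).
Proof.
move=> su; apply: (@smooth_alg_rsmooth _ _ _ (@flat R) (@flat_deriv R)).
  by move=> k y; exact: is_derive_flat.
by apply: Alg_comp; apply: Alg_smooth.
Qed.

(* With f(t) = e^(-1/t), the function f(c - f(|x|^2/r^2 - 1/4)) / f(c) for c = f(3/4) works. *)
Lemma cutoff_exists (r : R) : 0 < r -> exists chi : 'rV[R]_N -> R,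
  [/\ rsmooth chi, (forall x, sqnorm x <= r ^+ 2 / 4 -> chi x = 1) &
      (forall x, r ^+ 2 <= sqnorm x -> chi x = 0)].
Proof.
move=> r0; pose c := flat (1 : {poly R}) (3 / 4).
have fc0 : 0 < flat 1 c by apply: flat_gt0; apply: flat_gt0; rewrite divr_gt0.
have r20 : 0 < r ^+ 2 by rewrite exprn_gt0.
exists (fun x => (flat 1 c)^-1 * flat 1 (c + (-1) * flat 1 (r ^- 2 * sqnorm x + - 4^-1))).
split.
- apply/rsmoothZ/rsmooth_flat/rsmoothD; first exact: rsmooth_cst.
  apply/rsmoothZ/rsmooth_flat/rsmoothD; last exact: rsmooth_cst.
  exact/rsmoothZ/rsmooth_sqnorm.
- move=> x xr; rewrite [flat 1 (_ * _ - _)]flat_le0 ?mulr0 ?addr0 ?mulVf ?gt_eqF//.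
  by rewrite subr_le0 mulrC ler_pdivrMr// mulrC.
- move=> x xr; rewrite [X in _ * X]flat_le0 ?mulr0// mulN1r subr_le0 flat_homo//.
  have : 1 <= r ^- 2 * sqnorm x by rewrite mulrC ler_pdivlMr// mul1r.
  lra.
Qed.
End Cutoff.

(** * Dominated continuous functions and the iterated integral *)
Section LineIntegral.
Variable R : realType.
Local Notation mu := (@lebesgue_measure R).
Implicit Types (f g h : R -> R).

Definition dominant h :=
  [/\ continuous h, (forall x, 0 <= h x) & mu.-integrable setT (EFin \o h)].

Lemma continuous_measurable_EFin f :
  continuous f -> measurable_fun [set: measurableTypeR R] (EFin \o f).
Proof. by move=> cf; apply/measurable_EFinP; apply: continuous_measurable_fun; exact: cf. Qed.

Lemma dominated_integrableR h f (D : R) : dominant h -> continuous f ->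
  (forall x, `|f x| <= D * h x) -> mu.-integrable setT (EFin \o f).
Proof.
move=> [ch h0 ih] cf fh.
apply: (@le_integrable _ _ R mu setT measurableT _ (EFin \o (fun x => D * h x))).
- exact: continuous_measurable_EFin.
- by move=> x _ /=; rewrite lee_fin (le_trans (fh x))// ler_norm.
- by have := integrableZl measurableT D ih; apply: eq_integrable => // x _; rewrite /= EFinM.
Qed.

Lemma le_norm_Rintegral_dominant h f (D : R) : dominant h -> continuous f ->
  (forall x, `|f x| <= D * h x) -> `|Rintegral mu setT f| <= D * Rintegral mu setT h.
Proof.
move=> dh cf fh; have [ch h0 ih] := dh.
have iF := dominated_integrableR dh cf fh.
apply: le_trans (le_normr_Rintegral measurableT iF) _.
rewrite -RintegralZl//; apply: le_Rintegral => //; first exact: integrable_norm.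
have := integrableZl measurableT D ih.
by apply: eq_integrable => // x _; rewrite /= EFinM.
Qed.

Lemma cvg_Rintegral_dominant h (f_ : nat -> R -> R) f (D : R) : dominant h ->
  (forall n, continuous (f_ n)) -> continuous f ->
  (forall n x, `|f_ n x| <= D * h x) ->
  (forall x, f_ n x @[n --> \oo] --> f x) ->
  Rintegral mu setT (f_ n) @[n --> \oo] --> Rintegral mu setT f.
Proof.
move=> dh cf_ cf fh ff; have [ch h0 ih] := dh.
have iD : mu.-integrable setT (EFin \o (fun x => D * h x)).
  have := integrableZl measurableT D ih.
  by apply: eq_integrable => // x _; rewrite /= EFinM.
have [] := @dominated_convergence _ _ R mu setT measurableT
  (fun n => EFin \o f_ n) (EFin \o f) (EFin \o (fun x => D * h x)).
- by move=> n; exact: continuous_measurable_EFin.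
- exact: continuous_measurable_EFin.
- by apply: aeW => x _; apply: cvg_EFin; [exact: nearW|exact: ff].
- exact: iD.
- by apply: aeW => x n _ /=; rewrite lee_fin.
move=> iF _ H; apply: fine_cvg; rewrite fineK; first exact: H.
exact: integrable_fin_num.
Qed.

(** Substitution along the increasing map x -> a x. With nonnegative integrands and extended real
    values, the identity also transfers finiteness of the integral. *)
Lemma ge0_integral_dilate f (a : R) : 0 < a -> continuous f -> (forall x, 0 <= f x) ->
  (\int[mu]_x (f x)%:E = a%:E * \int[mu]_x (f (a * x))%:E)%E.
Proof.
move=> a0 cf f0.
have da (x : R) : is_derive x 1 ( *%R a) a.
  have := @is_deriveZ _ _ _ id a x 1 1 (is_derive_id _ _).
  by rewrite /GRing.scale/= mulr1.
have dE : ( *%R a)^`()%classic = fun=> a.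
  by apply/funext => x; rewrite derive1E; case: (da x).
rewrite (@increasing_ge0_integration_by_substitutionT R ( *%R a) f) ?dE//.
- rewrite -ge0_integralZl//.
  + by apply: eq_integral => x _; rewrite /= mulrC EFinM.
  + apply: continuous_measurable_EFin => x.
    by apply: continuous_comp; [exact: mulrl_continuous|exact: cf].
  + by move=> x _; rewrite lee_fin.
  + by rewrite lee_fin ltW.
- by move=> x y xy; rewrite ltr_pM2l.
- exact: cst_continuous.
- exact: is_cvg_cst.
- exact: is_cvg_cst.
- by apply/gt0_cvgMrNy => //; exact: cvg_id.
- by apply/gt0_cvgMry => //; exact: cvg_id.
Qed.

Lemma continuous_dilate f (a : R) : continuous f -> continuous (fun x => f (a * x)).
Proof. by move=> cf x; apply: continuous_comp; [exact: mulrl_continuous|exact: cf]. Qed.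

Lemma dominant_dilate h (a : R) : 0 < a -> dominant h -> dominant (fun x => a * h (a * x)).
Proof.
move=> a0 [ch h0 ih]; have ch' := continuous_dilate (a := a) ch.
have cah : continuous (fun x => a * h (a * x)).
  by move=> x; apply: continuousM; [exact: cst_continuous|exact: ch'].
split => //; first by move=> x; rewrite mulr_ge0// ltW.
apply/integrableP; split.
  exact: continuous_measurable_EFin.
move/integrableP : ih => [_]; congr (_ < _)%E.
under eq_integral do rewrite gee0_abs ?lee_fin//=.
rewrite (ge0_integral_dilate a0)// -ge0_integralZl//.
- apply: eq_integral => x _ /=.
  by rewrite ger0_norm ?mulr_ge0 ?(ltW a0)// EFinM.
- exact: continuous_measurable_EFin.
- by move=> x _; rewrite lee_fin.
- by rewrite lee_fin ltW.
Qed.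

Lemma ge0_Rintegral_dilate f (a : R) : 0 < a -> continuous f -> (forall x, 0 <= f x) ->
  mu.-integrable setT (EFin \o f) ->
  Rintegral mu setT f = a * Rintegral mu setT (fun x => f (a * x)).
Proof.
move=> a0 cf f0 iF.
have [ch hh ih] := dominant_dilate a0 (And3 cf f0 iF).
have ifa : mu.-integrable setT (EFin \o (fun x => f (a * x))).
  have := integrableZl measurableT a^-1 ih; apply: eq_integrable => // x _ /=.
  by rewrite -EFinM mulKf// gt_eqF.
rewrite /Rintegral (ge0_integral_dilate a0 cf f0) fineM//.
exact: (integrable_fin_num _ ifa).
Qed.

(** Writing f = (|f| + f) - |f| reduces signed functions to two continuous nonnegative ones. *)
Lemma Rintegral_dilate h f (a D : R) : 0 < a -> dominant h -> continuous f ->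
  (forall x, `|f x| <= D * h x) ->
  Rintegral mu setT f = a * Rintegral mu setT (fun x => f (a * x)).
Proof.
move=> a0 dh cf fh; have [ch h0 ih] := dh.
have cn : continuous (fun x => `|f x|).
  by move=> x; apply: continuous_comp; [exact: cf|exact: norm_continuous].
have cs : continuous (fun x => `|f x| + f x).
  by move=> x; apply: cvgD; [exact: cn|exact: cf].
have n0 x : 0 <= `|f x| by [].
have s0 x : 0 <= `|f x| + f x by rewrite -lerBlDr sub0r -normrN ler_norm.
have iN : mu.-integrable setT (EFin \o (fun x => `|f x|)).
  by apply: (dominated_integrableR dh cn (D := D)) => x; rewrite normr_id.
have iS : mu.-integrable setT (EFin \o (fun x => `|f x| + f x)).
  apply: (dominated_integrableR dh cs (D := D + D)) => x.
  by rewrite mulrDl (le_trans (ler_normD _ _))// lerD// normr_id.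
have iF := dominated_integrableR dh cf fh.
have aE g : continuous g -> (forall x, 0 <= g x) -> mu.-integrable setT (EFin \o g) ->
    mu.-integrable setT (EFin \o (fun x => g (a * x))).
  move=> cg g0 ig; have [_ _ ih'] := dominant_dilate a0 (And3 cg g0 ig).
  have := integrableZl measurableT a^-1 ih'; apply: eq_integrable => // x _ /=.
  by rewrite -EFinM mulKf// gt_eqF.
have -> : Rintegral mu setT f =
    Rintegral mu setT (fun x => `|f x| + f x) - Rintegral mu setT (fun x => `|f x|).
  by rewrite -RintegralB//; congr Rintegral; apply/funext => x; rewrite addrAC subrr add0r.
have -> : Rintegral mu setT (fun x => f (a * x)) =
    Rintegral mu setT (fun x => `|f (a * x)| + f (a * x)) -
    Rintegral mu setT (fun x => `|f (a * x)|).
  rewrite -RintegralB//; [|exact: (aE _ cs s0 iS)|exact: (aE _ cn n0 iN)].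
  by congr Rintegral; apply/funext => x; rewrite addrAC subrr add0r.
by rewrite (ge0_Rintegral_dilate a0 cs s0 iS) (ge0_Rintegral_dilate a0 cn n0 iN) mulrBr.
Qed.

Definition oneDsqrV (x : R) : R := (1 + x ^+ 2)^-1.

(** The function is even and its integral over the positive half-line is pi/2. *)
Lemma dominant_oneDsqrV : dominant oneDsqrV.
Proof.
have c : continuous oneDsqrV by exact: continuous_oneDsqrV.
have p x : 0 <= oneDsqrV x by rewrite invr_ge0 addr_ge0// sqr_ge0.
split=> //; apply/integrableP; split.
  exact: continuous_measurable_EFin.
under eq_integral do rewrite gee0_abs ?lee_fin//.
rewrite ge0_symfun_integralT//=; last by move=> x; rewrite /oneDsqrV /= sqrrN.
rewrite [X in (_ * X)%E](_ : _ = (pi / 2)%:E); first by rewrite -EFinM ltry.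
by rewrite -integral0y_oneDsqr set_itvcy.
Qed.
End LineIntegral.

(** * The iterated integral of functions dominated by a product *)

Section IteratedIntegral.
Variable R : realType.
Local Notation mu := (@lebesgue_measure R).

Definition slice n (x : R) (y : 'rV[R]_n) : 'rV[R]_n.+1 := row_mx (x%:M) y.

(** A product majorant is stable under slicing: fixing the first coordinate at [x] only replaces [C]
    by [C * h x]. *)
Definition dominated n (h : R -> R) (C : R) (f : 'rV[R]_n -> R) :=
  continuous f /\ forall x, `|f x| <= C * \prod_i h (x 0 i).

Lemma slice0 n x (y : 'rV[R]_n) : slice x y 0 ord0 = x.
Proof.
transitivity (row_mx (x%:M : 'M[R]_1) y 0 (lshift n 0)); last by rewrite row_mxEl mxE eqxx mulr1n.
by congr (row_mx _ _ _ _); apply: val_inj.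
Qed.

Lemma sliceS n x (y : 'rV[R]_n) i : slice x y 0 (lift ord0 i) = y 0 i.
Proof.
transitivity (row_mx (x%:M : 'M[R]_1) y 0 (rshift 1 i)); last by rewrite row_mxEr.
by congr (row_mx _ _ _ _); apply: val_inj.
Qed.

Lemma prod_slice n (h : R -> R) x (y : 'rV[R]_n) :
  \prod_i h (slice x y 0 i) = h x * \prod_i h (y 0 i).
Proof.
rewrite big_ord_recl slice0; congr (_ * _).
by apply: eq_bigr => i _; rewrite sliceS.
Qed.

Lemma slice_dilate n (a x : R) (y : 'rV[R]_n) : a *: slice x y = slice (a * x) (a *: y).
Proof.
apply/rowP => j; rewrite mxE !mxE.
case: (fintype.split _) => k; rewrite !mxE ?mulrnAr//.
Qed.

Lemma cvg_slice n (T : Type) (F : set_system T) (FF : Filter F)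
    (a : T -> R) (b : T -> 'rV[R]_n) (x : R) (y : 'rV[R]_n) :
  a t @[t --> F] --> x -> b t @[t --> F] --> y ->
  slice (a t) (b t) @[t --> F] --> slice x y.
Proof.
move=> ax bY; apply/cvg_ballP => e e0; near=> t.
have ha : ball x e (a t) by near: t; exact: (cvg_ball ax).
have [_ hb] : ball y e (b t) by near: t; exact: (cvg_ball bY).
split=> // i j; rewrite /slice !mxE; case: (fintype.split _) => k; last exact: hb.
by rewrite !mxE !ord1 eqxx !mulr1n.
Unshelve. all: by end_near. Qed.

Lemma continuous_slice n (f : 'rV[R]_n.+1 -> R) x :
  continuous f -> continuous (fun y => f (slice x y)).
Proof.
move=> cf y; apply: continuous_comp; last exact: cf.
exact: (@cvg_slice _ _ _ _ (fun=> x) id _ _ (cvg_cst x) (@cvg_id _ (nbhs y))).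
Qed.

Lemma dominated_slice n h C (f : 'rV[R]_n.+1 -> R) x :
  dominated h C f -> dominated h (C * h x) (fun y => f (slice x y)).
Proof.
move=> [cf fC]; split; first exact: continuous_slice.
by move=> y; rewrite -mulrA -prod_slice.
Qed.

Lemma intRS n (f : 'rV[R]_n.+1 -> R) :
  intR f = Rintegral mu setT (fun x => intR (fun y => f (slice x y))).
Proof. by []. Qed.

Section Dominant.
Variables (h : R -> R) (B : R).
Hypotheses (dh : dominant h) (hB : forall x, h x <= B).
Local Notation H := (Rintegral mu setT h).

Let h0 x : 0 <= h x. Proof. by case: dh. Qed.

Definition intR_cvg n := forall C (f_ : nat -> 'rV[R]_n -> R) f,
  (forall k, dominated h C (f_ k)) -> dominated h C f ->
  (forall x, f_ k x @[k --> \oo] --> f x) ->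
  intR (f_ k) @[k --> \oo] --> intR f.

Lemma intR_cvg_continuous n C (f : 'rV[R]_n.+1 -> R) : intR_cvg n -> dominated h C f ->
  continuous (fun x => intR (fun y => f (slice x y))).
Proof.
move=> IHc [cf fC] x; apply/(@cvg_nbhsP R R^o) => u ux.
(* The bound [B] on [h] yields one constant for all slices, so dominated convergence applies along
   any sequence [u] tending to [x]. *)
have dB z : dominated h (`|C| * B) (fun y => f (slice z y)).
  split=> [|y]; first exact: continuous_slice.
  apply: le_trans (fC _) _; rewrite prod_slice mulrA ler_wpM2r ?prodr_ge0//.
  by apply: (@le_trans _ _ (`|C| * h z)); [rewrite ler_wpM2r ?ler_norm|rewrite ler_wpM2l].
apply: (IHc (`|C| * B) (fun k y => f (slice (u k) y))) => [k||y]; [exact: dB|exact: dB|].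
exact: (cvg_comp _ _ (cvg_slice _ ux (cvg_cst y)) (cf _)).
Qed.

(** Both claims go through one induction: the bound on inner integrals dominates the outer
    integrand, and convergence in dimension n makes that integrand continuous, hence measurable. *)
Lemma intR_dominated n :
  (forall C (f : 'rV[R]_n -> R), dominated h C f -> `|intR f| <= C * H ^+ n) /\
  intR_cvg n.
Proof.
elim: n => [|n [IHb IHc]].
  split=> [C f [_ /(_ 0)]|C f_ f _ _ ff]; last exact: ff.
  by rewrite big_ord0 expr0.
have cI C f := @intR_cvg_continuous n C f IHc.
split=> [C f df|C f_ f df_ df ff].
- rewrite intRS exprSr mulrA; apply: (le_norm_Rintegral_dominant dh (cI _ _ df)).
  by move=> x; rewrite mulrAC; apply: IHb; exact: dominated_slice.
- apply: (@cvg_Rintegral_dominant _ h _ _ (C * H ^+ n) dh) => [k|||].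
  + exact: cI (df_ k).
  + exact: cI df.
  + by move=> k x; rewrite mulrAC; apply: IHb; exact: dominated_slice.
  + move=> x; apply: (IHc (C * h x)); [|exact: dominated_slice|].
      by move=> k; exact: dominated_slice.
    by move=> y; exact: ff.
Qed.

Lemma le_norm_intR n C (f : 'rV[R]_n -> R) : dominated h C f -> `|intR f| <= C * H ^+ n.
Proof. by have [+ _] := intR_dominated n; apply. Qed.

Lemma continuous_intR_slice n C (f : 'rV[R]_n.+1 -> R) : dominated h C f ->
  continuous (fun x => intR (fun y => f (slice x y))).
Proof. by have [_ /intR_cvg_continuous] := intR_dominated n; apply. Qed.

Lemma intR_slice_le n C (f : 'rV[R]_n.+1 -> R) x : dominated h C f ->
  `|intR (fun y => f (slice x y))| <= C * H ^+ n * h x.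
Proof. by move=> df; rewrite mulrAC; apply: le_norm_intR; exact: dominated_slice. Qed.

Lemma dominatedD n C D (f g : 'rV[R]_n -> R) : dominated h C f -> dominated h D g ->
  dominated h (C + D) (fun x => f x + g x).
Proof.
move=> [cf fC] [cg gD]; split=> [x|x]; first by apply: continuousD; [exact: cf|exact: cg].
by rewrite mulrDl (le_trans (ler_normD _ _))// lerD.
Qed.

Lemma dominatedZ n C a (f : 'rV[R]_n -> R) : dominated h C f ->
  dominated h (`|a| * C) (fun x => a * f x).
Proof.
move=> [cf fC]; split=> [x|x]; first by apply: continuousM; [exact: cst_continuous|exact: cf].
by rewrite normrM -mulrA ler_wpM2l.
Qed.

Lemma intRD n C D (f g : 'rV[R]_n -> R) : dominated h C f -> dominated h D g ->
  intR (fun x => f x + g x) = intR f + intR g.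
Proof.
elim: n C D f g => [//|n IH] C D f g df dg; rewrite !intRS.
rewrite -RintegralD//.
- congr Rintegral; apply/funext => x.
  exact: (IH _ _ _ _ (dominated_slice x df) (dominated_slice x dg)).
- apply: (dominated_integrableR dh (continuous_intR_slice df)) => x.
  exact: (intR_slice_le x df).
- apply: (dominated_integrableR dh (continuous_intR_slice dg)) => x.
  exact: (intR_slice_le x dg).
Qed.

Lemma intRZ n C a (f : 'rV[R]_n -> R) : dominated h C f ->
  intR (fun x => a * f x) = a * intR f.
Proof.
elim: n C f => [//|n IH] C f df; rewrite !intRS -RintegralZl//.
- congr Rintegral; apply/funext => x.
  exact: (IH _ _ (dominated_slice x df)).
- apply: (dominated_integrableR dh (continuous_intR_slice df)) => x.
  exact: (intR_slice_le x df).
Qed.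

Lemma intR_dilate n C a (f : 'rV[R]_n -> R) : 0 < a -> dominated h C f ->
  intR f = a ^+ n * intR (fun x => f (a *: x)).
Proof.
move=> a0; elim: n C f => [|n IH] C f df.
  by rewrite expr0 mul1r /= scaler0.
rewrite !intRS (Rintegral_dilate a0 dh (continuous_intR_slice df)
  (fun x => intR_slice_le x df)) exprS -mulrA; congr (_ * _).
have ia : mu.-integrable setT (EFin \o (fun x => intR (fun y => f (slice (a * x) y)))).
  apply: (dominated_integrableR (D := C * H ^+ n * a^-1) (dominant_dilate a0 dh)).
    exact: (continuous_dilate (a := a) (continuous_intR_slice df)).
  move=> x; apply: le_trans (intR_slice_le (a * x) df) _.
  by rewrite -[leRHS]mulrA mulKf// gt_eqF.
have an0 : a ^+ n != 0 by rewrite expf_neq0// gt_eqF.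
(* The induction hypothesis, read backwards on each slice, contributes the factor a^(-n). *)
have -> : (fun x => intR (fun y => f (a *: slice x y))) =
    fun x => (a ^+ n)^-1 * intR (fun y => f (slice (a * x) y)).
  apply/funext => x; rewrite (IH _ _ (dominated_slice (a * x) df)) mulKf//.
  by congr intR; apply/funext => y; rewrite slice_dilate.
by rewrite RintegralZl// mulVKf.
Qed.
End Dominant.
End IteratedIntegral.

(** * Weighted seminorms *)
Section Weight.
Variables (R : realType) (N : nat).
Implicit Types (u v : 'rV[R]_N -> R) (x : 'rV[R]_N) (s : seq 'I_N).

Definition weight x : R := \prod_i (1 + x 0 i ^+ 2).

Lemma weight_ge1 x : 1 <= weight x.
Proof.
rewrite /weight; elim/big_ind: _ => // [a b a1 b1|i _].
  by rewrite -[1]mulr1 ler_pM.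
by rewrite lerDl sqr_ge0.
Qed.

Lemma weight_gt0 x : 0 < weight x.
Proof. exact: lt_le_trans ltr01 (weight_ge1 x). Qed.

Lemma weight_ge0 x : 0 <= weight x.
Proof. exact: ltW (weight_gt0 x). Qed.

Lemma sqnorm_ge0 x : 0 <= sqnorm x.
Proof. by apply: sumr_ge0 => i _; exact: sqr_ge0. Qed.

(** Expanding the product gives 1, the squares of the coordinates and further nonnegative terms. *)
Lemma sqnorm_weight x : 1 + sqnorm x <= weight x.
Proof.
rewrite /sqnorm /weight; elim: (index_enum _) => [|i l IH].
  by rewrite !big_nil addr0.
rewrite !big_cons; set S := \sum_(j <- l) _ in IH *.
have S0 : 0 <= S by apply: sumr_ge0 => j _; exact: sqr_ge0.
have i0 : 0 <= x 0 i ^+ 2 by exact: sqr_ge0.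
apply: (@le_trans _ _ ((1 + x 0 i ^+ 2) * (1 + S))).
  by rewrite mulrDl mul1r mulrDr mulr1 !addrA [1 + S + _]addrAC lerDl mulr_ge0.
by rewrite ler_wpM2l// addr_ge0.
Qed.

Lemma weight_dilate (e : R) x : 0 <= e <= 1 -> weight (e *: x) <= weight x.
Proof.
move=> /andP[e0 e1]; apply: ler_prod => i _; rewrite addr_ge0 ?sqr_ge0//=.
by rewrite mxE exprMn lerD2l ler_piMl ?sqr_ge0// exprn_ile1.
Qed.

Lemma weight_leX x (j k : nat) : (j <= k)%N -> weight x ^+ j <= weight x ^+ k.
Proof. by apply: ler_weXn2l; exact: weight_ge1. Qed.

(** Hence decay like 1/W is exactly domination by the product of integrable functions 1/(1 +
    y^2). *)
Lemma prod_oneDsqrV x : \prod_i oneDsqrV (x 0 i) = (weight x)^-1.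
Proof. by rewrite /weight prodfV. Qed.

Lemma norm_monomial_le (b : multi_index N) x :
  `|monomial b x| <= weight x ^+ mi_abs b.
Proof.
rewrite /monomial normr_prod /weight -prodrXl; apply: ler_prod => i _.
rewrite normr_ge0/= normrX.
have b1 : 1 <= 1 + x 0 i ^+ 2 by rewrite lerDl sqr_ge0.
apply: (@le_trans _ _ ((1 + x 0 i ^+ 2) ^+ b i)).
  apply: lerXn2r; rewrite ?nnegrE ?(le_trans ler01 b1)//.
  rewrite -[x 0 i ^+ 2]ger0_norm ?sqr_ge0// normrX.
  have [x1|/ltW x1] := leP `|x 0 i| 1; first by rewrite (le_trans x1)// lerDl sqr_ge0.
  by rewrite -[leLHS]add0r lerD// expr2 ler_peMl.
by rewrite ler_weXn2l// /mi_abs (bigD1 i)//= leq_addr.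
Qed.

(** The Schwartz seminorm is expressed by an upper bound [M] instead of a supremum, so that
    estimates combine directly. *)
Definition seminorm_le (k n : nat) (M : R) u :=
  forall s x, (size s <= n)%N -> weight x ^+ k * `|riter s u x| <= M.

Definition rschwartz u := rsmooth u /\ forall k n, exists M, seminorm_le k n M u.

Lemma seminorm_le_weaken k n k' n' M u : (k <= k')%N -> (n <= n')%N ->
  seminorm_le k' n' M u -> seminorm_le k n M u.
Proof.
move=> kk nn H s x sn; apply: le_trans (H s x (leq_trans sn nn)).
by rewrite ler_wpM2r// weight_leX.
Qed.

Lemma seminorm_le_ge0 k n M u : seminorm_le k n M u -> 0 <= M.
Proof.
move=> H; apply: le_trans (H [::] 0 (leq0n _)).
by rewrite mulr_ge0// exprn_ge0// weight_ge0.
Qed.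

Lemma seminorm_le_pt k n M u s x : seminorm_le k n M u -> (size s <= n)%N ->
  `|riter s u x| <= M / weight x ^+ k.
Proof.
by move=> H sn; rewrite ler_pdivlMr ?exprn_gt0 ?weight_gt0// mulrC H.
Qed.

(** Only finitely many index lists have length at most [n]. The induction peels off the innermost
    partial and adds the bounds over its N possible directions. *)
Lemma seminorm_le_exists k u :
  (forall s, exists M, forall x, weight x ^+ k * `|riter s u x| <= M) ->
  forall n, exists M, seminorm_le k n M u.
Proof.
move=> H n; elim: n u H => [|n IH] u H.
  by have [M HM] := H [::]; exists M => -[|//] x _; exact: HM.
have {}IH i : exists M, seminorm_le k n M (rpartial i u).
  by apply: IH => s; have [M HM] := H (rcons s i); exists M => x; rewrite -riter_rcons.
have [M0 HM0] := H [::]; have [F HF] := choice IH.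
have M00 : 0 <= M0.
  by apply: le_trans (HM0 0); rewrite mulr_ge0// exprn_ge0// weight_ge0.
have F0 i : 0 <= F i by exact: seminorm_le_ge0 (HF i).
exists (M0 + \sum_i F i) => s x.
case/lastP: s => [_|s i].
  by apply: le_trans (HM0 x) _; rewrite lerDl sumr_ge0.
rewrite size_rcons ltnS riter_rcons => /(HF i s x) /le_trans; apply.
by rewrite -[leLHS]add0r lerD// (bigD1 i)//= lerDl sumr_ge0.
Qed.

Lemma continuous_sqnorm : continuous (@sqnorm R N).
Proof. exact/rsmooth_continuous/rsmooth_sqnorm. Qed.

Lemma open_sqnorm_gt (r : R) : open [set x : 'rV[R]_N | r < sqnorm x].
Proof. exact: (open_comp (fun x _ => continuous_sqnorm (x := x)) (@open_gt R r)). Qed.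

Lemma open_sqnorm_lt (r : R) : open [set x : 'rV[R]_N | sqnorm x < r].
Proof. exact: (open_comp (fun x _ => continuous_sqnorm (x := x)) (@open_lt R r)). Qed.

Lemma compact_sqnorm_le (r : R) : compact [set x : 'rV[R]_N | sqnorm x <= r].
Proof.
apply: bounded_closed_compact; last first.
  rewrite (_ : mkset _ = ~` [set x | r < sqnorm x]); last first.
    by apply/seteqP; split=> x /=; rewrite leNgt => /negP.
  exact/open_closedC/open_sqnorm_gt.
(* A coordinate is either at most 1 in absolute value or at most its own square, hence at most [r];
   no square root is involved. *)
exists (1 + r); split; first exact: num_real.
move=> M rM x /= xr; apply: le_trans (ltW rM).
have r0 : 0 <= r by apply: le_trans xr; exact: sqnorm_ge0.
rewrite [leLHS]/Num.Def.normr/= mx_normrE; apply/bigmax_leP.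
split=> [|[i j] _ /=]; first by rewrite addr_ge0.
have xj : `|x i j| ^+ 2 <= r.
  apply: le_trans xr; rewrite -normrX ger0_norm ?sqr_ge0// /sqnorm (bigD1 j)//=.
  by rewrite ord1 lerDl sumr_ge0// => k _; exact: sqr_ge0.
have [y1|/ltW y1] := leP `|x i j| 1; first by rewrite (le_trans y1)// lerDl.
by rewrite -[leLHS]add0r lerD// (le_trans _ xj)// expr2 ler_peMl.
Qed.

Lemma rsmooth_weight : rsmooth weight.
Proof.
rewrite /weight; elim: (index_enum _) => [|i l IH].
  rewrite (_ : (fun _ => _) = fun=> 1); first exact: rsmooth_cst.
  by apply/funext => y; rewrite big_nil.
rewrite (_ : (fun y : 'rV[R]_N => _) = fun y => (1 + y 0 i * y 0 i) *
    \prod_(j <- l) (1 + y 0 j ^+ 2)); last by apply/funext => y; rewrite big_cons.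
apply: (rsmoothM _ IH); apply: (rsmoothD (@rsmooth_cst R N 1)).
by apply: rsmoothM; exact: rsmooth_coord.
Qed.

(** Each weighted derivative is continuous, so it attains a maximum on the compact ball, and it
    vanishes on the open exterior. *)
Lemma rschwartz_compact_support u (r : R) : rsmooth u ->
  (forall x, r ^+ 2 <= sqnorm x -> u x = 0) -> rschwartz u.
Proof.
move=> su u0; split=> // k; apply: seminorm_le_exists => s.
pose K := [set x : 'rV[R]_N | sqnorm x <= r ^+ 2].
have K0 : K 0.
  by rewrite /K /= /sqnorm big1 ?sqr_ge0// => i _; rewrite mxE expr0n.
have cf : continuous (fun x => weight x ^+ k * `|riter s u x|).
  move=> x; apply: (@continuousM _ _ (fun x => weight x ^+ k) (fun x => `|riter s u x|)).
    apply: (@continuous_comp _ _ _ weight (fun y => y ^+ k)).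
      exact/rsmooth_continuous/rsmooth_weight.
    exact: exprn_continuous.
  apply: (@continuous_comp _ _ _ (riter s u) (fun y => `|y|)).
    by apply: rsmooth_continuous; exact: rsmooth_riter.
  exact: norm_continuous.
have [c _ Hc] := @EVT_max_rV R N _ K (ex_intro _ _ K0) (@compact_sqnorm_le _)
  (continuous_subspaceT cf).
exists (weight c ^+ k * `|riter s u c|) => x.
have [xr|xr] := leP (sqnorm x) (r ^+ 2); first by apply: Hc; rewrite inE.
rewrite (riter_eq0 s (@open_sqnorm_gt (r ^+ 2)))//.
  by rewrite normr0 mulr0 mulr_ge0// exprn_ge0// weight_ge0.
by move=> y /= yr; apply: u0; exact: ltW.
Qed.

Lemma seminorm_leD k n M M' u v : rsmooth u -> rsmooth v ->
  seminorm_le k n M u -> seminorm_le k n M' v ->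
  seminorm_le k n (M + M') (fun x => u x + v x).
Proof.
move=> su sv uM vM s x sn; rewrite riterD//.
apply: (@le_trans _ _ (weight x ^+ k * (`|riter s u x| + `|riter s v x|))).
  by rewrite ler_wpM2l ?exprn_ge0 ?weight_ge0// ler_normD.
by rewrite mulrDr lerD// (uM, vM).
Qed.

Lemma seminorm_leZ k n M c u : rsmooth u ->
  seminorm_le k n M u -> seminorm_le k n (`|c| * M) (fun x => c * u x).
Proof.
move=> su uM s x sn; rewrite riterZ// normrM mulrCA ler_wpM2l//; exact: uM.
Qed.

Lemma rschwartz_rpartial i u : rschwartz u -> rschwartz (rpartial i u).
Proof.
move=> [su uM]; split=> [|k n]; first exact: rsmooth_rpartial.
have [M HM] := uM k n.+1; exists M => s x sn.
by rewrite -riter_rcons HM// size_rcons.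
Qed.

Lemma rschwartz_riter s u : rschwartz u -> rschwartz (riter s u).
Proof. by move=> su; elim: s => // i s IH; exact: rschwartz_rpartial. Qed.

Definition rscale (e : R) u x : R := e ^- N * u (e^-1 *: x).

Lemma rsmooth_rscale e u : rsmooth u -> rsmooth (rscale e u).
Proof. by move=> su; apply: rsmoothZ; exact: rsmooth_dilate. Qed.

Lemma riter_rscale e u s : rsmooth u ->
  riter s (rscale e u) = fun x => e ^- N * (e^-1 ^+ size s * riter s u (e^-1 *: x)).
Proof.
by move=> su; rewrite riterZ; [rewrite riter_dilate|exact: rsmooth_dilate].
Qed.

(** For e <= 1 the weight at x is at most the weight at x/e, so powers of it cost nothing. The loss
    is e^(-N) from the normalisation and at most e^(-n) from the derivatives. *)
Lemma seminorm_le_rscale e k n M u : rsmooth u -> 0 < e <= 1 ->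
  seminorm_le k n M u -> seminorm_le k n (e ^- (N + n) * M) (rscale e u).
Proof.
move=> su /andP[e0 e1] uM s x sn; rewrite riter_rscale//.
have M0 := seminorm_le_ge0 uM.
have x1 : weight x <= weight (e^-1 *: x).
  rewrite -{1}[x]scale1r -(@divff _ e) ?gt_eqF// -scalerA.
  by rewrite weight_dilate// (ltW e0).
rewrite !normrM !normrV ?unitfE ?expf_neq0 ?gt_eqF//.
rewrite normrX (ger0_norm (ltW e0)).
rewrite (ger0_norm (exprn_ge0 _ (ltW _))) ?invr_gt0//.
apply: (@le_trans _ _ (e ^- N * (e^-1 ^+ size s * (weight (e^-1 *: x) ^+ k *
    `|riter s u (e^-1 *: x)|)))).
  rewrite mulrCA; rewrite ler_wpM2l ?invr_ge0 ?exprn_ge0 ?(ltW e0)//.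
  rewrite mulrCA ler_wpM2l ?exprn_ge0 ?invr_ge0 ?(ltW e0)// ler_wpM2r//.
  by rewrite lerXn2r ?nnegrE ?weight_ge0.
rewrite exprD invfM -!mulrA ler_wpM2l ?invr_ge0 ?exprn_ge0 ?(ltW e0)//.
apply: ler_pM; rewrite ?exprn_ge0 ?invr_ge0 ?(ltW e0)//.
- by rewrite mulr_ge0 ?exprn_ge0 ?weight_ge0.
- by rewrite -exprVn ler_weXn2l// invf_ge1.
- exact: uM.
Qed.

Lemma rschwartz_rscale e u : 0 < e <= 1 -> rschwartz u -> rschwartz (rscale e u).
Proof.
move=> e01 [su uM]; split=> [|k n]; first exact: rsmooth_rscale.
by have [M HM] := uM k n; exists (e ^- (N + n) * M); exact: seminorm_le_rscale.
Qed.
End Weight.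

(** * Complex-valued functions and temperedness in weighted seminorms *)

Section ComplexValued.
Variables (R : realType) (N : nat).
Implicit Types (f g : fn R N) (u v : 'rV[R]_N -> R) (x : 'rV[R]_N) (s : seq 'I_N)
  (a b : multi_index N).

Lemma norm_Re_le (z : R[i]) : `|complex.Re z| <= normc z.
Proof.
case: z => x y /=; rewrite -sqrtr_sqr ler_sqrt ?addr_ge0 ?sqr_ge0//.
by rewrite lerDl sqr_ge0.
Qed.

Lemma norm_Im_le (z : R[i]) : `|complex.Im z| <= normc z.
Proof.
case: z => x y /=; rewrite -sqrtr_sqr ler_sqrt ?addr_ge0 ?sqr_ge0//.
by rewrite lerDr sqr_ge0.
Qed.

Lemma normc_le_ReIm (z : R[i]) : normc z <= `|complex.Re z| + `|complex.Im z|.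
Proof.
case: z => x y /=; have xy0 : 0 <= `|x| + `|y| by rewrite addr_ge0.
rewrite -[leRHS]ger0_norm// -sqrtr_sqr ler_sqrt ?sqr_ge0//.
by rewrite sqrrD !real_normK ?num_real// addrAC lerDl mulrn_wge0// mulr_ge0.
Qed.

Lemma normc_ge0 (z : R[i]) : 0 <= normc z.
Proof. exact: le_trans (normr_ge0 _) (norm_Re_le z). Qed.

Lemma normc_real (c : R) : normc c%:C = `|c|.
Proof. by rewrite /= expr0n addr0 sqrtr_sqr. Qed.

Lemma normc_sum (I : Type) (l : seq I) (F : I -> R[i]) :
  normc (\sum_(i <- l) F i) <= \sum_(i <- l) normc (F i).
Proof.
elim: l => [|i l IH]; first by rewrite !big_nil normc_real normr0.
by rewrite !big_cons (le_trans (le_normcD _ _))// lerD2l.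
Qed.

Lemma normc_sign n (z : R[i]) : normc ((-1) ^+ n * z) = normc z.
Proof.
elim: n => [|n IH]; first by rewrite expr0 mul1r.
by rewrite exprS mulN1r mulNr normcN.
Qed.

Lemma complexE (z : R[i]) : z = complex.Re z +i* complex.Im z.
Proof. by case: z. Qed.

Lemma fn_eq f g : cRe f = cRe g -> cIm f = cIm g -> f = g.
Proof.
move=> fgR fgI; apply/funext => x; rewrite [LHS]complexE [RHS]complexE.
by rewrite -/(cRe f x) -/(cRe g x) -/(cIm f x) -/(cIm g x) fgR fgI.
Qed.

Lemma cRe_iter_partial s f : cRe (iter_partial s f) = riter s (cRe f).
Proof. by elim: s => //= i s <-. Qed.

Lemma cIm_iter_partial s f : cIm (iter_partial s f) = riter s (cIm f).
Proof. by elim: s => //= i s <-. Qed.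

Lemma smoothP f : smooth f <-> rsmooth (cRe f) /\ rsmooth (cIm f).
Proof.
split=> [sf|[sR sI]].
  split=> s x; have [[cR cI] d] := sf s x.
    by rewrite -cRe_iter_partial; split=> // i; case: (d i).
  by rewrite -cIm_iter_partial; split=> // i; case: (d i).
move=> s x; rewrite /ccont_at /partial_exists cRe_iter_partial cIm_iter_partial.
have [cR dR] := sR s x; have [cI dI] := sI s x.
by split=> // i; split.
Qed.

(** Indices are listed in the order in which [dpow] applies its partials, so that [dpow] becomes an
    instance of [iter_partial]. *)
Definition mi_seq a : seq 'I_N := flatten [seq nseq (a i) i | i <- enum 'I_N].

Lemma dpowE a f : dpow a f = iter_partial (mi_seq a) f.
Proof.
rewrite /dpow /mi_seq; elim: (enum 'I_N) => //= i l ->.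
by elim: (a i) => //= n ->.
Qed.

Lemma count_mi_seq a i : count_mem i (mi_seq a) = a i.
Proof.
rewrite /mi_seq count_flatten -map_comp sumnE big_map big_enum /=.
rewrite (bigD1 i)//= count_nseq /= eqxx mul1n big1 ?addn0// => j ji.
by rewrite count_nseq /= (negbTE ji).
Qed.

Lemma size_mi_seq a : size (mi_seq a) = mi_abs a.
Proof.
rewrite /mi_seq size_flatten /shape -map_comp sumnE big_map big_enum /=.
by apply: eq_bigr => i _; rewrite size_nseq.
Qed.

Definition count_mi s : multi_index N := [ffun i => count_mem i s].

Lemma perm_mi_seq s : perm_eq s (mi_seq (count_mi s)).
Proof. by apply/allP => i _ /=; rewrite count_mi_seq ffunE. Qed.

Lemma cRe_dpow a f : cRe (dpow a f) = riter (mi_seq a) (cRe f).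
Proof. by rewrite dpowE cRe_iter_partial. Qed.

Lemma cIm_dpow a f : cIm (dpow a f) = riter (mi_seq a) (cIm f).
Proof. by rewrite dpowE cIm_iter_partial. Qed.

Definition mono_bounded (V : 'rV[R]_N -> R) :=
  forall b, exists M, forall x, `|monomial b x| * V x <= M.

Lemma mono_bounded_mul i V : mono_bounded V ->
  mono_bounded (fun x => (1 + x 0 i ^+ 2) * V x).
Proof.
move=> HV b; have [M HM] := HV b.
(* The factor x_i^2 is absorbed by raising the i-th exponent of the monomial by 2. *)
have [M' HM'] := HV [ffun j => (b j + (j == i).*2)%N].
exists (M + M') => x; rewrite mulrDl mul1r mulrDr lerD//.
apply: le_trans (HM' x); rewrite mulrA le_eqVlt; apply/orP; left; apply/eqP; congr (_ * _).
rewrite -[x 0 i ^+ 2]ger0_norm ?sqr_ge0// -normrM; congr (`|_|).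
rewrite /monomial (bigD1 i)//= [RHS](bigD1 i)//= ffunE eqxx exprD.
rewrite mulrAC; congr (_ * _); apply: eq_bigr => j ji.
by rewrite ffunE (negbTE ji) addn0.
Qed.

Lemma mono_bounded_weight k V : mono_bounded V ->
  mono_bounded (fun x => weight x ^+ k * V x).
Proof.
have wU U : mono_bounded U -> mono_bounded (fun x => weight x * U x).
  move=> HU; rewrite /weight; elim: (index_enum _) => [|i l IHl] b.
    by have [M HM] := HU b; exists M => x; rewrite big_nil mul1r.
  have [M HM] := mono_bounded_mul i IHl b.
  by exists M => x; rewrite big_cons -mulrA.
move=> HV; elim: k => [|k IH] b.
  by have [M HM] := HV b; exists M => x; rewrite mul1r.
by have [M HM] := wU _ IH b; exists M => x; rewrite exprS -[weight x * _ * _]mulrA.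
Qed.

Lemma mono_bounded0 V : mono_bounded V -> exists M, forall x, V x <= M.
Proof.
move=> /(_ [ffun => 0%N])[M HM]; exists M => x; apply: le_trans (HM x).
by rewrite /monomial big1 ?normr1 ?mul1r// => i _; rewrite ffunE.
Qed.

(** From monomials to weights: powers of the weight are absorbed into monomials factor by factor,
    and an index list is reordered into a multi-index. Conversely, a monomial x^b is at most
    W^|b|. *)
Lemma schwartzP f : schwartz f <-> rschwartz (cRe f) /\ rschwartz (cIm f).
Proof.
split.
  move=> [/smoothP[sR sI] H].
  have H' s : mono_bounded (fun x => normc (iter_partial (mi_seq (count_mi s)) f x)).
    move=> b; have [M HM] := H (count_mi s) b; exists M => x.
    by have := HM x; rewrite ComplexField.Normc.normcM normc_real dpowE.
  have bnd (P : R[i] -> R) u : (forall z, `|P z| <= normc z) -> rsmooth u ->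
      (forall s x, riter s u x = P (iter_partial s f x)) -> rschwartz u.
    move=> Pn su uP; split=> // k; apply: seminorm_le_exists => s.
    have [M HM] := mono_bounded0 (mono_bounded_weight k (H' s)).
    exists M => x; apply: le_trans (HM x).
    by rewrite ler_wpM2l ?exprn_ge0 ?weight_ge0// (riter_perm su (perm_mi_seq s)) uP.
  split.
    apply: (bnd (@complex.Re R)) => //; first exact: norm_Re_le.
    by move=> s x; rewrite -cRe_iter_partial.
  apply: (bnd (@complex.Im R)) => //; first exact: norm_Im_le.
  by move=> s x; rewrite -cIm_iter_partial.
move=> [[sR HR] [sI HI]]; split; first exact/smoothP.
move=> a b.
have [M HM] := HR (mi_abs b) (mi_abs a); have [M' HM'] := HI (mi_abs b) (mi_abs a).
exists (M + M') => x; rewrite ComplexField.Normc.normcM normc_real.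
apply: (@le_trans _ _ (weight x ^+ mi_abs b * normc (dpow a f x))).
  by rewrite ler_wpM2r ?normc_ge0// norm_monomial_le.
apply: (@le_trans _ _ (weight x ^+ mi_abs b *
    (`|cRe (dpow a f) x| + `|cIm (dpow a f) x|))).
  by rewrite ler_wpM2l ?exprn_ge0 ?weight_ge0// normc_le_ReIm.
by rewrite mulrDr cRe_dpow cIm_dpow lerD// (HM, HM') ?size_mi_seq.
Qed.

Definition weight_tempered (T : distr R N) :=
  (forall (c : R[i]) f g, schwartz f -> schwartz g ->
      T (fun x => c * f x + g x) = c * T f + T g) /\
  exists (K : R) (k : nat), forall f, schwartz f -> forall M : R,
    seminorm_le k k M (cRe f) -> seminorm_le k k M (cIm f) -> normc (T f) <= K * M.

Lemma tempered_weight (T : distr R N) : tempered T -> weight_tempered T.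
Proof.
(* The factor 2 comes from adding the bounds for the real and imaginary parts. *)
move=> [lT [K [k HT]]]; split=> //; exists (K * 2), k => f sf M MR MI.
rewrite -mulrA; apply: HT => // a b ak bk x; rewrite ComplexField.Normc.normcM normc_real.
apply: (@le_trans _ _ (weight x ^+ k * (`|cRe (dpow a f) x| + `|cIm (dpow a f) x|))).
  apply: ler_pM; rewrite ?normc_ge0 ?normc_le_ReIm//.
  exact: le_trans (norm_monomial_le _ _) (weight_leX _ bk).
rewrite mulrDr mulr_natl mulr2n cRe_dpow cIm_dpow.
by rewrite lerD// (MR, MI) ?size_mi_seq.
Qed.

Lemma seminorm_le_dominated k n M u : rsmooth u -> (0 < k)%N ->
  seminorm_le k n M u -> dominated (@oneDsqrV R) M u.
Proof.
move=> su k0 uM; split=> [|x]; first exact: rsmooth_continuous.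
have := @seminorm_le_pt _ _ _ _ _ _ [::] x (seminorm_le_weaken k0 (leqnn n) uM) (leq0n n).
by rewrite expr1 prod_oneDsqrV.
Qed.

Lemma oneDsqrV_ub (x : R) : oneDsqrV x <= 1.
Proof. exact: oneDsqrV_le1. Qed.

Lemma nintE f : nint f = (intR (cRe f) / (2 * pi) ^+ N) +i* (intR (cIm f) / (2 * pi) ^+ N).
Proof.
rewrite /nint /intC; set k := (2 * pi) ^+ N.
have -> : (k%:C)^-1 = (k^-1)%:C by rewrite -fmorphV.
by rewrite mulrC; apply/eqP; rewrite eq_complex /= !mul0r subr0 addr0 ![k^-1 * _]mulrC !eqxx.
Qed.

Lemma nint_linear (c : R[i]) f g : schwartz f -> schwartz g ->
  nint (fun x => c * f x + g x) = c * nint f + nint g.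
Proof.
move=> /schwartzP[[sfR fR] [sfI fI]] /schwartzP[[sgR gR] [sgI gI]].
have [A /(seminorm_le_dominated sfR (ltn0Sn _)) dA] := fR 1%N 0%N.
have [A' /(seminorm_le_dominated sfI (ltn0Sn _)) dA'] := fI 1%N 0%N.
have [B /(seminorm_le_dominated sgR (ltn0Sn _)) dB] := gR 1%N 0%N.
have [B' /(seminorm_le_dominated sgI (ltn0Sn _)) dB'] := gI 1%N 0%N.
have d1 := @dominant_oneDsqrV R.
case: c => p q; rewrite !nintE.
have -> : cRe (fun x => (p +i* q) * f x + g x) =
    fun x => (p * cRe f x + (- q) * cIm f x) + cRe g x.
  by apply/funext => x; rewrite /cRe /cIm /=; case: (f x) (g x) => [? ?] [? ?] /=; rewrite mulNr.
have -> : cIm (fun x => (p +i* q) * f x + g x) =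
    fun x => (p * cIm f x + q * cRe f x) + cIm g x.
  by apply/funext => x; rewrite /cRe /cIm /=; case: (f x) (g x) => [? ?] [? ?] /=.
rewrite (intRD d1 oneDsqrV_ub (dominatedD (dominatedZ p dA) (dominatedZ (- q) dA')) dB).
rewrite (intRD d1 oneDsqrV_ub (dominatedZ p dA) (dominatedZ (- q) dA')).
rewrite (intRD d1 oneDsqrV_ub (dominatedD (dominatedZ p dA') (dominatedZ q dA)) dB').
rewrite (intRD d1 oneDsqrV_ub (dominatedZ p dA') (dominatedZ q dA)).
rewrite !(intRZ d1 oneDsqrV_ub _ dA) !(intRZ d1 oneDsqrV_ub _ dA').
by apply/eqP; rewrite eq_complex /=; apply/andP; split; apply/eqP; ring.
Qed.

(** The constant depends on [h] through its integral only, not through [B]. This gives estimates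
    uniform in e for kernels whose supremum blows up as e tends to 0. *)
Lemma normc_nint_le (h : R -> R) (B C : R) f : dominant h -> (forall y : R, h y <= B) ->
  dominated h C (cRe f) -> dominated h C (cIm f) ->
  normc (nint f) <= (2 * (Rintegral (@lebesgue_measure R) setT h) ^+ N / (2 * pi) ^+ N) * C.
Proof.
move=> dh hB dR dI; rewrite nintE; apply: le_trans (normc_le_ReIm _) _ => /=.
have p0 : 0 < (2 * pi : R) ^+ N by rewrite exprn_gt0// mulr_gt0// pi_gt0.
rewrite !normrM normfV (gtr0_norm p0) -mulrDl mulrAC ler_wpM2r ?invr_ge0 ?(ltW p0)//.
have := lerD (le_norm_intR dh hB dR) (le_norm_intR dh hB dI).
by move/le_trans; apply; rewrite le_eqVlt; apply/orP; left; apply/eqP; ring.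
Qed.

Lemma weight_tempered_minus_const (T : distr R N) (c : R[i]) :
  weight_tempered T -> weight_tempered (minus_const T c).
Proof.
move=> [lT [K [k HT]]]; split=> [d f g sf sg|].
  by rewrite /minus_const lT// nint_linear//; ring.
set L := 2 * (Rintegral (@lebesgue_measure R) setT (@oneDsqrV R)) ^+ N / (2 * pi) ^+ N.
(* One more power of the weight ensures integrability against the constant, even for k = 0. *)
exists (K + normc c * L), k.+1 => f sf M MR MI.
have [[sR _] [sI _]] := (schwartzP f).1 sf.
rewrite /minus_const; apply: le_trans (le_normcD _ _) _.
rewrite normcN ComplexField.Normc.normcM mulrDl lerD//.
  apply: HT => //; [exact: seminorm_le_weaken MR|exact: seminorm_le_weaken MI].
rewrite -mulrA ler_wpM2l ?normc_ge0//.
apply: (normc_nint_le (@dominant_oneDsqrV R) oneDsqrV_ub).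
- exact: (seminorm_le_dominated sR (ltn0Sn k) MR).
- exact: (seminorm_le_dominated sI (ltn0Sn k) MI).
Qed.
End ComplexValued.

(** * Scaling estimates *)
Section CutoffEstimates.
Variables (R : realType) (N : nat).
Implicit Types (u chi : 'rV[R]_N -> R) (x : 'rV[R]_N) (s : seq 'I_N).

(** The two summands of the splitting, before rescaling. *)
Definition localize chi (e : R) u x : R := chi (e *: x) * u x.
Definition remainder chi (e : R) u x : R := u x + (-1) * localize chi e u x.

Lemma rsmooth_localize chi e u : rsmooth chi -> rsmooth u -> rsmooth (localize chi e u).
Proof. by move=> sc su; exact: (rsmoothM (rsmooth_dilate e sc) su). Qed.

(** Derivatives of chi(e x) carry powers of e, at most 1, so the Leibniz estimate is uniform in
    e. *)
Lemma seminorm_le_localize chi u k n : rschwartz chi -> rschwartz u ->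
  exists M, forall e : R, 0 <= e <= 1 -> seminorm_le k n M (localize chi e u).
Proof.
move=> [sc bc] [su bu]; have [A HA] := bc 0%N n; have [M HM] := bu k n.
exists (2 ^+ n * (A * M)) => e /andP[e0 e1] s x sn.
rewrite mulrC -ler_pdivlMr ?exprn_gt0 ?weight_gt0//.
rewrite -!mulrA; apply: (riterM_le (rsmooth_dilate e sc) su) sn.
- move=> s' s'n; rewrite riter_dilate// normrM ger0_norm ?exprn_ge0//.
  have := HA s' (e *: x) s'n; rewrite mul1r; apply: le_trans.
  by rewrite ler_piMl// exprn_ile1.
- by move=> s' s'n; exact: seminorm_le_pt HM s'n.
Qed.

Lemma rsmooth_remainder chi e u : rsmooth chi -> rsmooth u -> rsmooth (remainder chi e u).
Proof.
by move=> sc su; exact: (rsmoothD su (rsmoothZ (-1) (rsmooth_localize e sc su))).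
Qed.

Lemma seminorm_le_remainder chi u k n : rschwartz chi -> rschwartz u ->
  exists M, forall e : R, 0 <= e <= 1 -> seminorm_le k n M (remainder chi e u).
Proof.
move=> bc bu; have [A HA] := seminorm_le_localize k n bc bu.
have [sc _] := bc; have [su /(_ k n)[M HM]] := bu.
exists (M + `|-1| * A) => e e01; have sl := rsmooth_localize e sc su.
exact: (seminorm_leD su (rsmoothZ (-1) sl) HM (seminorm_leZ (-1) sl (HA e e01))).
Qed.

(* The remainder vanishes unless |x| > r / (2 e), where one power of the weight gains a
   factor e^2. *)
Lemma seminorm_le_remainder_decay chi u (r : R) k n m : 0 < r ->
  (forall x, sqnorm x <= r ^+ 2 / 4 -> chi x = 1) ->
  rschwartz chi -> rschwartz u ->
  exists M, forall e : R, 0 < e <= 1 -> seminorm_le k n (e ^+ (2 * m) * M) (remainder chi e u).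
Proof.
move=> r0 chi1 bc bu; have [M HM] := seminorm_le_remainder (k + m) n bc bu.
exists ((4 / r ^+ 2) ^+ m * M) => e /andP[e0 e1] s x sn.
have {}HM := HM e; rewrite (ltW e0) e1 in HM.
have {}HM := HM isT.
have M0 := seminorm_le_ge0 HM.
have r2 : 0 < r ^+ 2 by rewrite exprn_gt0.
have [xs|xs] := ltP (sqnorm x) (r ^+ 2 / 4 / e ^+ 2).
  rewrite (riter_eq0 s (@open_sqnorm_lt R N (r ^+ 2 / 4 / e ^+ 2)))//.
    by rewrite normr0 mulr0 !mulr_ge0// ?exprn_ge0 ?(ltW e0)// divr_ge0// ltW.
  move=> y /= ys; rewrite /remainder /localize chi1; first by rewrite mul1r mulN1r subrr.
  have -> : sqnorm (e *: y) = e ^+ 2 * sqnorm y.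
    by rewrite /sqnorm mulr_sumr; apply: eq_bigr => i _; rewrite mxE exprMn.
  by rewrite mulrC -ler_pdivlMr ?exprn_gt0// ltW.
(* Since this quantity is at least 1 here, its m-th power can be inserted as a factor; the [m] spare
   powers of the weight in [HM] pay for it. *)
have W1 : 1 <= e ^+ 2 * (4 / r ^+ 2) * weight x.
  have : r ^+ 2 / 4 / e ^+ 2 <= weight x.
    by apply: (le_trans xs); apply: le_trans (sqnorm_weight x); rewrite lerDr.
  have c0 : 0 <= e ^+ 2 * (4 / r ^+ 2) by rewrite mulr_ge0 ?sqr_ge0// divr_ge0// ltW.
  move=> /(ler_wpM2l c0) /(le_trans _); apply.
  by rewrite le_eqVlt; apply/orP; left; apply/eqP; field; rewrite !gt_eqF.
rewrite mulrA exprM -exprMn.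
apply: (@le_trans _ _ ((e ^+ 2 * (4 / r ^+ 2) * weight x) ^+ m *
   (weight x ^+ k * `|riter s (remainder chi e u) x|))).
  by rewrite ler_peMl ?exprn_ege1// mulr_ge0// exprn_ge0// weight_ge0.
rewrite [(_ * weight x) ^+ m]exprMn -[leLHS]mulrA ler_wpM2l//.
  by rewrite exprn_ge0// mulr_ge0 ?sqr_ge0// divr_ge0// ltW.
by rewrite mulrA -exprD addnC; exact: HM.
Qed.

Lemma seminorm_le_rscale_remainder chi u (r d : R) k : 0 < r ->
  (forall x, sqnorm x <= r ^+ 2 / 4 -> chi x = 1) ->
  rschwartz chi -> rschwartz u ->
  exists M, forall e : R, 0 < e <= 1 ->
    seminorm_le k k (M * e `^ d) (rscale e (remainder chi e u)).
Proof.
move=> r0 chi1 bc bu.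
pose j := (Num.trunc `|d|).+1.
(* An integer exponent [j] above [d] suffices, since e^j <= e^d for 0 < e <= 1, whatever the sign of
   [d]. *)
have dj : d <= j%:R.
  by apply: le_trans (ler_norm _) _; rewrite ltW// /j truncnS_gt.
(* Chosen so that e^(2m) compensates the loss e^(-(N+k)) of rescaling and still leaves at least
   e^j. *)
pose m := (N + k + j)%N.
have [M HM] := @seminorm_le_remainder_decay chi u r k k m r0 chi1 bc bu.
have M0 : 0 <= M.
  have := HM 1; rewrite ltr01 lexx => /(_ isT)/seminorm_le_ge0.
  by rewrite expr1n mul1r.
exists M => e e01 s x sk.
have [e0 e1] := andP e01.
have [[sc _] [su _]] := (bc, bu).
apply: le_trans (seminorm_le_rscale (rsmooth_remainder e sc su) e01 (HM e e01) _ sk) _.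
rewrite mulrA mulrC ler_wpM2l//.
have -> : e ^- (N + k) * e ^+ (2 * m) = e ^+ (N + k + j + j).
  rewrite /m (_ : (2 * _ = (N + k) + (N + k + j + j))%N); last by lia.
  by rewrite (exprD e (N + k) (N + k + j + j)) mulKf// expf_neq0// gt_eqF.
apply: (@le_trans _ _ (e ^+ j)).
  by rewrite ler_wiXn2l ?(ltW e0)// leq_addl.
by rewrite -powR_mulrn ?(ltW e0)// ger_powR.
Qed.
End CutoffEstimates.

(** * Domination of a single term of the local representation *)

Section LocalEstimate.
Variables (R : realType) (N : nat).
Implicit Types (u t d chi : 'rV[R]_N -> R) (x q : 'rV[R]_N).

(** Nothing is known of [t] outside [O], but off the closed set [K] the product vanishes near each
    point. *)
Lemma continuousM_support (O K : set 'rV[R]_N) t d : closed K -> K `<=` O ->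
  (forall q, O q -> {for q, continuous t}) -> continuous d ->
  (forall q, ~ K q -> d q = 0) -> continuous (fun q => t q * d q).
Proof.
move=> cK KO ct cd d0 q; have [Kq|nKq] := pselect (K q).
  by apply: (@continuousM _ _ t d); [exact/ct/KO|exact: cd].
have H : {near q, (fun=> 0) =1 (fun q => t q * d q)}.
  have oK : nbhs q (~` K) by apply: open_nbhs_nbhs; split => //; exact: closed_openC.
  by apply: filterS oK => y /d0 ->; rewrite mulr0.
rewrite /continuous_at d0// mulr0.
exact: (cvg_trans (near_eq_cvg H) (@cvg_cst _ (0 : R) _ (nbhs q) _)).
Qed.

(** An L^1-normalised rescaling: its integral is independent of e, and the product over the
    coordinates is the rescaled 1/W. *)
Definition cauchy_kernel (e y : R) : R := e^-1 * oneDsqrV (e^-1 * y).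

Lemma dominant_cauchy_kernel (e : R) : 0 < e -> dominant (cauchy_kernel e).
Proof. by move=> e0; apply: dominant_dilate; [rewrite invr_gt0|exact: dominant_oneDsqrV]. Qed.

Lemma cauchy_kernel_le (e y : R) : 0 < e -> cauchy_kernel e y <= e^-1.
Proof. by move=> e0; rewrite ler_piMr ?invr_ge0 ?(ltW e0)// oneDsqrV_ub. Qed.

Lemma Rintegral_cauchy_kernel (e : R) : 0 < e ->
  Rintegral (@lebesgue_measure R) setT (cauchy_kernel e) =
  Rintegral (@lebesgue_measure R) setT (@oneDsqrV R).
Proof.
move=> e0; have ei0 : 0 < e^-1 by rewrite invr_gt0.
have d1 := @dominant_oneDsqrV R; have [c1 p1 _] := d1.
rewrite (@Rintegral_dilate R _ _ _ 1 ei0 d1 c1); last first.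
  by move=> x; rewrite mul1r ger0_norm.
have [_ _ ie] := dominant_cauchy_kernel e0.
rewrite -RintegralZl//.
have := integrableZl measurableT e ie; apply: eq_integrable => // x _ /=.
by rewrite -EFinM mulVKf// gt_eqF.
Qed.

Lemma prod_cauchy_kernel (e : R) q : \prod_i cauchy_kernel e (q 0 i) = e ^- N * (weight (e^-1 *: q))^-1.
Proof.
rewrite -prod_oneDsqrV big_split /= prodr_const card_ord exprVn; congr (_ * _).
by apply: eq_bigr => i _; rewrite mxE.
Qed.

(** With q = e p, it rests on |p| <= 1 + |p|^2 <= W(p). *)
Lemma enorm_le (e : R) q : 0 < e -> enorm q <= e * weight (e^-1 *: q).
Proof.
move=> e0; set p := e^-1 *: q.
have -> : q = e *: p by rewrite /p scalerA divff ?gt_eqF// scale1r.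
have -> : enorm (e *: p) = e * Num.sqrt (sqnorm p).
  rewrite /enorm -[e in RHS]ger0_norm ?(ltW e0)// -sqrtr_sqr -sqrtrM ?sqr_ge0//.
  rewrite /sqnorm mulr_sumr; congr Num.sqrt; apply: eq_bigr => i _.
  by rewrite mxE exprMn.
rewrite ler_pM2l//; apply: le_trans (sqnorm_weight p).
have s0 := sqnorm_ge0 p.
set y := Num.sqrt _; rewrite -(sqr_sqrtr s0) -/y.
have [y1|/ltW y1] := leP y 1; first by rewrite (le_trans y1)// lerDl sqr_ge0.
by rewrite -[leLHS]add0r lerD// expr2 ler_peMl// (le_trans ler01).
Qed.

(* Substituting q = e p, the factor |q|^(delta+n) is at most e^(delta+n) times a power
   of the weight of p; the n derivatives falling on the rescaled function cost e^(-n).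
   *)
Lemma dominated_term (O : set 'rV[R]_N) t u chi (r c delta M e : R) (k n : nat) s :
  0 < e <= 1 -> [set x | sqnorm x <= r ^+ 2] `<=` O ->
  (forall q, O q -> {for q, continuous t}) ->
  0 <= c -> 0 <= delta + n%:R <= k%:R ->
  (forall q, O q -> `|t q| <= c * (enorm q) `^ (delta + n%:R)) ->
  rsmooth chi -> rsmooth u -> (forall x, r ^+ 2 <= sqnorm x -> chi x = 0) ->
  seminorm_le k.+1 n M (localize chi e u) -> size s = n ->
  dominated (cauchy_kernel e) (c * M * e `^ delta)
    (fun q => t q * riter s (rscale e (localize chi e u)) q).
Proof.
move=> /andP[e0 e1] KO ct c0 /andP[p0 pk] tb sc su chi0 cutM sn.
set d := riter s _.
have ssc := rsmooth_localize e sc su.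
have dK q : ~ [set x | sqnorm x <= r ^+ 2] q -> d q = 0.
  move=> /= /negP; rewrite -ltNge => qr.
  apply: (riter_eq0 s (@open_sqnorm_gt R N (r ^+ 2))) qr => y /= yr.
  rewrite /rscale /localize scalerA divff ?gt_eqF// scale1r chi0 ?mul0r ?mulr0//.
  exact: ltW.
split.
  apply: (@continuousM_support O [set x | sqnorm x <= r ^+ 2]) => //.
    by apply: compact_closed; [exact: norm_hausdorff|exact: compact_sqnorm_le].
  exact/rsmooth_continuous/rsmooth_riter/rsmooth_rscale.
move=> q; rewrite prod_cauchy_kernel; set p := e^-1 *: q.
have M0 := seminorm_le_ge0 cutM.
have ea0 : 0 <= e `^ delta by exact: powR_ge0.
have [Kq|nKq] := pselect ([set x | sqnorm x <= r ^+ 2] q); last first.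
  rewrite dK// mulr0 normr0 !mulr_ge0 ?invr_ge0 ?exprn_ge0 ?(ltW e0)//.
  exact: weight_ge0.
have tq : `|t q| <= c * (e `^ (delta + n%:R) * weight p ^+ k).
  apply: le_trans (tb _ (KO _ Kq)) _; rewrite ler_wpM2l//.
  have W1 := weight_ge1 p; have W0 := weight_ge0 p.
  apply: (@le_trans _ _ ((e * weight p) `^ (delta + n%:R))).
    apply: ge0_ler_powR => //; rewrite ?nnegrE ?sqrtr_ge0 ?mulr_ge0 ?(ltW e0)//.
    exact: enorm_le.
  rewrite powRM ?(ltW e0)// ler_wpM2l ?powR_ge0//.
  by rewrite -powR_mulrn// ler_powR.
have dq : `|d q| <= e ^- N * (e ^- n * (M / weight p ^+ k.+1)).
  rewrite /d riter_rscale// sn !normrM.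
  have i0 m : 0 <= e ^- m by rewrite invr_ge0 exprn_ge0// ltW.
  rewrite exprVn (ger0_norm (i0 N)) (ger0_norm (i0 n)) !ler_wpM2l//.
  by apply: (seminorm_le_pt p cutM); rewrite sn.
rewrite normrM; apply: le_trans (ler_pM _ _ tq dq) _ => //.
rewrite powRD; last by apply/implyP => _; rewrite gt_eqF.
(* The factors e^n and e^(-n) cancel, and k of the k + 1 inverse powers of the weight offset the
   growth of [t]; one is left for the kernel. *)
rewrite powR_mulrn ?(ltW e0)// le_eqVlt; apply/orP; left; apply/eqP.
have w0 : weight p != 0 by rewrite gt_eqF// weight_gt0.
have eN : e != 0 by rewrite gt_eqF.
by rewrite exprS; field; rewrite w0 !expf_neq0.
Qed.
End LocalEstimate.

(** * The scaling estimate and the three assertions *)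

Section Main.
Variables (R : realType) (N : nat).
Implicit Types (T : distr R N) (g : fn R N) (delta : R).

Definition complex_fn (u v : 'rV[R]_N -> R) : fn R N := fun x => u x +i* v x.

Lemma schwartz_complex_fn u v : rschwartz u -> rschwartz v -> schwartz (complex_fn u v).
Proof. by move=> su sv; apply/schwartzP. Qed.

Lemma cRe_scale g (e : R) : cRe (scale g e) = rscale e (cRe g).
Proof.
by apply/funext => x; rewrite /rscale /cRe /scale; case: (g _) => a b /=; rewrite mul0r subr0.
Qed.

Lemma cIm_scale g (e : R) : cIm (scale g e) = rscale e (cIm g).
Proof.
by apply/funext => x; rewrite /rscale /cIm /scale; case: (g _) => a b /=; rewrite mul0r addr0.
Qed.

Lemma nint_term_le (O : set 'rV[R]_N) (t g : fn R N) (chi : 'rV[R]_N -> R)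
    (a : multi_index N) (r c delta : R) :
  [set x | sqnorm x <= r ^+ 2] `<=` O ->
  (forall q, O q -> ccont_at t q) ->
  (delta + (mi_abs a)%:R < 0 -> forall q, O q -> t q = 0) ->
  (forall q, O q -> normc (t q) <= c * (enorm q) `^ (delta + (mi_abs a)%:R)) ->
  rschwartz chi -> (forall x, r ^+ 2 <= sqnorm x -> chi x = 0) -> schwartz g ->
  exists C, forall e : R, 0 < e <= 1 ->
   normc (nint (fun q => t q * dpow a (complex_fn (rscale e (localize chi e (cRe g)))
     (rscale e (localize chi e (cIm g)))) q)) <= C * e `^ delta.
Proof.
move=> KO ct t0 tb bc chi0 /schwartzP[bR bI].
set n := mi_abs a in t0 tb *; set dn := delta + n%:R in t0 tb *.
have [[[sc _] [sR _]] [sI _]] := (bc, bR, bI).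
pose k := (Num.trunc `|dn|).+1.
have dk : dn <= k%:R.
  by apply: le_trans (ler_norm _) _; rewrite ltW// /k truncnS_gt.
have [MR HR] := seminorm_le_localize k.+1 n bc bR.
have [MI HI] := seminorm_le_localize k.+1 n bc bI.
set L := 2 * (Rintegral (@lebesgue_measure R) setT (@oneDsqrV R)) ^+ N / (2 * pi) ^+ N.
(* A common nonnegative bound for both parts of [g]. The factor 2 in the next witness arises because
   each part of a complex product is a combination of two real products. *)
pose M : R := `|MR| + `|MI|.
exists (L * (2 * (`|c| * M))) => e e01; have [e0 e1] := andP e01.
have e01' : 0 <= e <= 1 by rewrite (ltW e0).
have toM (B : R) (u : 'rV[R]_N -> R) : B <= M -> seminorm_le k.+1 n B u -> seminorm_le k.+1 n M u.
  by move=> BM uB s x sn; apply: le_trans BM; exact: uB.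
have {HR}HR : seminorm_le k.+1 n M (localize chi e (cRe g)).
  by apply: (toM MR (localize chi e (cRe g)) _ (HR e e01')); rewrite (le_trans (ler_norm MR))// lerDl.
have {HI}HI : seminorm_le k.+1 n M (localize chi e (cIm g)).
  by apply: (toM MI (localize chi e (cIm g)) _ (HI e e01')); rewrite (le_trans (ler_norm MI))// lerDr.
have M0 : 0 <= M by rewrite addr_ge0.
have dominated0 (f : 'rV[R]_N -> R) : (forall q, f q = 0) ->
    dominated (cauchy_kernel e) (`|c| * M * e `^ delta) f.
  move=> f0; rewrite (_ : f = fun=> 0); last exact/funext.
  split=> [|q]; first exact: cst_continuous.
  rewrite normr0 prod_cauchy_kernel !mulr_ge0 ?powR_ge0 ?invr_ge0 ?exprn_ge0 ?(ltW e0)//.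
  exact: weight_ge0.
have dom (t1 u : 'rV[R]_N -> R) : (forall q, `|t1 q| <= normc (t q)) ->
    (forall q, O q -> {for q, continuous t1}) -> rsmooth u ->
    seminorm_le k.+1 n M (localize chi e u) ->
    dominated (cauchy_kernel e) (`|c| * M * e `^ delta)
      (fun q => t1 q * riter (mi_seq a) (rscale e (localize chi e u)) q).
  move=> t1t ct1 su Hu; have [dn0|dn0] := ltP dn 0.
    (* For a negative exponent the coefficient vanishes on [O], and outside the ball the cutoff
       kills the other factor. *)
    apply: dominated0 => q; have [qr|qr] := leP (sqnorm q) (r ^+ 2).
      have -> : t1 q = 0.
        apply/eqP; rewrite -normr_le0 (le_trans (t1t q))// t0//; last exact: KO.
        by rewrite normc_real normr0.
      by rewrite mul0r.
    rewrite (riter_eq0 (mi_seq a) (@open_sqnorm_gt R N (r ^+ 2)) _ qr) ?mulr0// => y /= yr.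
    rewrite /rscale /localize scalerA divff ?gt_eqF// scale1r chi0 ?mul0r ?mulr0//.
    exact: ltW.
  apply: (@dominated_term _ _ O t1 u chi r `|c| delta M e k n) => //.
  - by rewrite -/dn dn0 dk.
  - move=> q Oq; apply: le_trans (t1t q) _; apply: le_trans (tb q Oq) _.
    by rewrite ler_wpM2r ?powR_ge0 ?ler_norm.
  - by rewrite size_mi_seq.
have ctR q : O q -> {for q, continuous (cRe t)} by move=> /ct[].
have ctI q : O q -> {for q, continuous (cIm t)} by move=> /ct[].
have tR q : `|cRe t q| <= normc (t q) by exact: norm_Re_le.
have tI q : `|cIm t q| <= normc (t q) by exact: norm_Im_le.
set phi := complex_fn _ _.
have -> : L * (2 * (`|c| * M)) * e `^ delta =
    L * (`|c| * M * e `^ delta + `|c| * M * e `^ delta) by ring.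
(* Replacing the integral by that of the kernel at scale e is what makes the constant [L] serve all
   e at once. *)
rewrite /L -(Rintegral_cauchy_kernel e0).
apply: (@normc_nint_le _ _ _ e^-1) => [|y||].
- exact: dominant_cauchy_kernel.
- exact: cauchy_kernel_le.
- rewrite (_ : cRe _ = fun q => cRe t q * riter (mi_seq a) (cRe phi) q +
      (-1) * (cIm t q * riter (mi_seq a) (cIm phi) q)); last first.
    apply/funext => q; rewrite -cRe_dpow -cIm_dpow /cRe /cIm.
    by case: (t q) (dpow a phi q) => [? ?] [? ?] /=; rewrite mulN1r.
  have := dominatedD (dom _ _ tR ctR sR HR) (dominatedZ (-1) (dom _ _ tI ctI sI HI)).
  by rewrite normrN1 mul1r.
- rewrite (_ : cIm _ = fun q => cRe t q * riter (mi_seq a) (cIm phi) q +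
      cIm t q * riter (mi_seq a) (cRe phi) q); last first.
    apply/funext => q; rewrite -cRe_dpow -cIm_dpow /cRe /cIm.
    by case: (t q) (dpow a phi q) => [? ?] [? ?] /=; rewrite addrC.
  exact: (dominatedD (dom _ _ tR ctR sI HI) (dom _ _ tI ctI sR HR)).
Qed.

Lemma Odist_scale_le T delta g : weight_tempered T -> Odist T delta -> schwartz g ->
  exists K, forall e : R, 0 < e <= 1 -> normc (T (scale g e)) <= K * e `^ delta.
Proof.
move=> [lT [K [k HT]]] [U [oU U0 [ta [A [_ [_ [ta0 [cta [tab TE]]]]]]]]] sg.
have [bR bI] := (schwartzP g).1 sg.
have [sR _] := bR; have [sI _] := bI.
have [/= rho rho0 rhoU] : nbhs_ball (0 : 'rV[R]_N) U.
  exact/nbhs_ballP/open_nbhs_nbhs.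
(* Halving places the closed Euclidean ball of radius [r] inside the open sup-norm ball of radius
   [rho]. *)
pose r := rho / 2; have r0 : 0 < r by rewrite divr_gt0.
have KU : [set x | sqnorm x <= r ^+ 2] `<=` U.
  move=> x /= xr; apply: rhoU; split=> // i j; rewrite /ball /= mxE sub0r normrN.
  apply: (@le_lt_trans _ _ r); last by rewrite /r ltr_pdivrMr// ltr_pMr// ltr1n.
  rewrite -ler_sqr ?nnegrE ?(ltW r0)//; apply: le_trans xr.
  rewrite -normrX ger0_norm ?sqr_ge0// /sqnorm (bigD1 j)//= ord1.
  by rewrite lerDl sumr_ge0// => l _; exact: sqr_ge0.
have [chi [sc chi1 chi0]] := @cutoff_exists R N r r0.
have bc := rschwartz_compact_support sc chi0.
pose phi e := complex_fn (rscale e (localize chi e (cRe g))) (rscale e (localize chi e (cIm g))).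
pose tau e := complex_fn (rscale e (remainder chi e (cRe g))) (rscale e (remainder chi e (cIm g))).
have HC a : exists C, forall e, 0 < e <= 1 ->
    normc (nint (fun q => ta a q * dpow a (phi e) q)) <= C * e `^ delta.
  have [c Hc] := tab a.
  by apply: (@nint_term_le U (ta a) g chi a r c delta) => //; [exact: cta|exact: ta0].
have [F HF] := choice HC.
have [MR HMR] := @seminorm_le_rscale_remainder R N chi (cRe g) r delta k r0 chi1 bc bR.
have [MI HMI] := @seminorm_le_rscale_remainder R N chi (cIm g) r delta k r0 chi1 bc bI.
exists (\sum_(a <- A) F a + K * (`|MR| + `|MI|)) => e e01.
have [e0 e1] := andP e01.
have e01' : 0 <= e <= 1 by rewrite (ltW e0).
have localize_schwartz u : rschwartz u -> rschwartz (rscale e (localize chi e u)).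
  move=> bu; have [su _] := bu; apply: (rschwartz_rscale e01); split=> [|k' n'].
    exact: (rsmooth_localize e sc su).
  by have [M HM] := seminorm_le_localize k' n' bc bu; exists M; exact: HM.
have remainder_schwartz u : rschwartz u -> rschwartz (rscale e (remainder chi e u)).
  move=> bu; have [su _] := bu; apply: (rschwartz_rscale e01); split=> [|k' n'].
    exact: (rsmooth_remainder e sc su).
  by have [M HM] := seminorm_le_remainder k' n' bc bu; exists M; exact: HM.
have sphi : schwartz (phi e) by apply: schwartz_complex_fn; exact: localize_schwartz.
have stau : schwartz (tau e) by apply: schwartz_complex_fn; exact: remainder_schwartz.
have -> : scale g e = fun x => 1 * phi e x + tau e x.
  have uE u x : rscale e u x = rscale e (localize chi e u) x + rscale e (remainder chi e u) x.
    by rewrite /rscale -mulrDr /remainder mulN1r addrCA subrr addr0.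
  apply: fn_eq; apply/funext => x.
    by rewrite cRe_scale uE /cRe mul1r.
  by rewrite cIm_scale uE /cIm mul1r.
rewrite lT// mul1r mulrDl; apply: le_trans (le_normcD _ _) _; apply: lerD.
  (* Rescaling turns chi(e x) into chi(x), so [phi e] is supported in the same ball inside [U] for
     every e, and the local representation applies. *)
  rewrite TE; last first.
    split; first by have [] := sphi.
    exists [set x | sqnorm x <= r ^+ 2]; split=> //; first exact: compact_sqnorm_le.
    move=> x /= /negP; rewrite -ltNge => /ltW xr.
    by rewrite /phi /complex_fn /rscale /localize !scalerA !divff ?gt_eqF// !scale1r chi0//
      !mul0r !mulr0.
  apply: le_trans (normc_sum _ _) _; rewrite mulr_suml; apply: ler_sum => a _.
  by rewrite normc_sign; exact: HF.
rewrite -mulrA; apply: HT => // s x sk.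
  apply: le_trans (HMR e e01 s x sk) _; rewrite ler_wpM2r ?powR_ge0//.
  by rewrite (le_trans (ler_norm MR))// lerDl.
apply: le_trans (HMI e e01 s x sk) _; rewrite ler_wpM2r ?powR_ge0//.
by rewrite (le_trans (ler_norm MI))// lerDr.
Qed.

Lemma powR_bound_small (z : R -> R[i]) (K delta : R) : 0 < delta ->
  (forall e : R, 0 < e <= 1 -> normc (z e) <= K * e `^ delta) ->
  forall eps : R, 0 < eps -> exists d : R, 0 < d /\
    forall e : R, 0 < e < d -> normc (z e) < eps.
Proof.
move=> d0 H eps eps0; have K1 : 0 < `|K| + 1 by rewrite ltr_wpDl.
pose y := eps / (`|K| + 1); have y0 : 0 < y by rewrite divr_gt0.
have yd0 : 0 < y `^ delta^-1 by rewrite powR_gt0.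
(* Below the second entry, e^delta is less than eps / (|K| + 1); the entry 1 keeps e in the range of
   the hypothesis. *)
exists (Num.min 1 (y `^ delta^-1)); split; first by rewrite lt_min ltr01.
move=> e /andP[e0]; rewrite lt_min => /andP[e1 ey].
have ed : e `^ delta < y.
  have := gt0_ltr_powR d0 (_ : e \in Num.nneg) (_ : y `^ delta^-1 \in Num.nneg) ey.
  rewrite !nnegrE (ltW e0) powR_ge0 -powRrM mulVf ?gt_eqF// powRr1 ?(ltW y0)//.
  exact.
apply: le_lt_trans (H e _) _; first by rewrite e0 ltW.
apply: (@le_lt_trans _ _ ((`|K| + 1) * e `^ delta)).
  by rewrite ler_wpM2r ?powR_ge0// (le_trans (ler_norm _))// lerDl.
by rewrite mulrC -ltr_pdivlMr.
Qed.

Lemma intR_rscale (u : 'rV[R]_N -> R) (e : R) : 0 < e <= 1 -> rschwartz u ->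
  intR (rscale e u) = intR u.
Proof.
move=> e01 bu; have [e0 e1] := andP e01.
have [su /(_ 1%N 0%N)[M HM]] := bu.
have [su' /(_ 1%N 0%N)[M' HM']] := rschwartz_rscale e01 bu.
have d1 := @dominant_oneDsqrV R.
have du := seminorm_le_dominated su (ltn0Sn _) HM.
have du' := seminorm_le_dominated su' (ltn0Sn _) HM'.
have ei : 0 < e^-1 by rewrite invr_gt0.
rewrite [RHS](intR_dilate d1 (@oneDsqrV_ub R) ei du).
have eN : e ^+ N != 0 by rewrite expf_neq0// gt_eqF.
have -> : (fun x => u (e^-1 *: x)) = (fun x => e ^+ N * rscale e u x).
  by apply/funext => x; rewrite /rscale mulVKf.
by rewrite (intRZ d1 (@oneDsqrV_ub R) _ du') exprVn mulKf.
Qed.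

Lemma nint_scale g (e : R) : 0 < e <= 1 -> schwartz g -> nint (scale g e) = nint g.
Proof.
by move=> e01 /schwartzP[bR bI]; rewrite !nintE cRe_scale cIm_scale !intR_rscale.
Qed.

Lemma schwartz_dpow (a : multi_index N) g : schwartz g -> schwartz (dpow a g).
Proof.
by move=> /schwartzP[bR bI]; apply/schwartzP; rewrite cRe_dpow cIm_dpow;
  split; exact: rschwartz_riter.
Qed.

Lemma schwartz_scale g (e : R) : 0 < e <= 1 -> schwartz g -> schwartz (scale g e).
Proof.
by move=> e01 /schwartzP[bR bI]; apply/schwartzP; rewrite cRe_scale cIm_scale;
  split; exact: rschwartz_rscale.
Qed.

Lemma schwartz0 : schwartz ((fun=> 0) : fn R N).
Proof.
have b0 : rschwartz ((fun=> 0) : 'rV[R]_N -> R).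
  split=> [|k n]; first exact: rsmooth_cst.
  by exists 0 => s x _; rewrite riter_cst0 normr0 mulr0.
exact/schwartzP.
Qed.

Lemma weight_temperedZ T (c : R[i]) g : weight_tempered T -> schwartz g ->
  T (fun x => c * g x) = c * T g.
Proof.
move=> [lT _] sg.
have T0 : T (fun=> 0) = 0.
  (* Linearity at zero reads T 0 = T 0 + T 0. *)
  have := lT 1 (fun=> 0) (fun=> 0) schwartz0 schwartz0.
  rewrite (_ : (fun x => _) = fun=> 0); last by apply/funext => x; rewrite mulr0 addr0.
  by rewrite mul1r => /eqP; rewrite -subr_eq subrr eq_sym => /eqP.
rewrite -[RHS]addr0 -T0 -lT//; last exact: schwartz0.
by congr T; apply/funext => x; rewrite addr0.
Qed.

Lemma dpow_scale (a : multi_index N) g (e : R) : schwartz g ->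
  dpow a (scale g e) = fun x => (e^-1 ^+ mi_abs a)%:C * scale (dpow a g) e x.
Proof.
move=> /schwartzP[[sR _] [sI _]]; apply: fn_eq; apply/funext => x.
  rewrite cRe_dpow cRe_scale riter_rscale// size_mi_seq -cRe_dpow.
  by rewrite /scale /cRe; case: (dpow a g _) => p q /=; ring.
rewrite cIm_dpow cIm_scale riter_rscale// size_mi_seq -cIm_dpow.
by rewrite /scale /cIm; case: (dpow a g _) => p q /=; ring.
Qed.
End Main.

Theorem theorem3p5 (R : realType) (N : nat) :
  (* (A) *)
  (forall (T : distr R N) (delta : R), tempered T -> Odist T delta ->
     forall g : fn R N, schwartz g ->
       exists K e0 : R, 0 < e0 /\
         forall e : R, 0 < e < e0 -> normc (T (scale g e)) <= K * e `^ delta) /\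
  (* (B) *)
  (forall (T : distr R N) (delta : R) (c : R[i]), tempered T -> 0 < delta ->
     Odist (minus_const T c) delta -> has_value_at0 T c) /\
  (* (C) *)
  (forall (T : distr R N) (delta : R) (w : nat), tempered T -> (0 < w)%N ->
     w%:R < delta + 1 -> Odist T delta -> zero_of_order T w).
Proof.
split; [|split].
- move=> T delta /tempered_weight wT oT g sg.
  have [K HK] := Odist_scale_le wT oT sg.
  by exists K, 1; split=> // e /andP[e0 e1]; apply: HK; rewrite e0 ltW.
- move=> T delta c /tempered_weight wT d0 oT g sg g1.
  have [K HK] := Odist_scale_le (weight_tempered_minus_const c wT) oT sg.
  apply: (powR_bound_small d0 (K := K)) => e e01.
  (* The rescaled [g] still has normalised integral 1, so T - c paired with it is the pairing of T
     minus c. *)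
  by have := HK e e01; rewrite /minus_const nint_scale// g1 mulr1.
- move=> T delta w /tempered_weight wT w0 wd oT a aw g sg _.
  have sag := schwartz_dpow a sg.
  have [K HK] := Odist_scale_le wT oT sag.
  (* From |a| + 1 <= w < delta + 1. *)
  have da : 0 < delta - (mi_abs a)%:R.
    have : (mi_abs a).+1%:R <= w%:R :> R by rewrite ler_nat.
    by rewrite -natr1; lra.
  apply: (powR_bound_small da (K := K)) => e e01.
  have [e0 e1] := andP e01.
  rewrite subr0 /dist_deriv normc_sign dpow_scale// weight_temperedZ//; last exact: schwartz_scale.
  rewrite ComplexField.Normc.normcM normc_real.
  rewrite ger0_norm ?exprn_ge0 ?invr_ge0 ?(ltW e0)// powRB; last by apply/implyP => _; rewrite gt_eqF.
  rewrite powR_mulrn ?(ltW e0)// exprVn mulrC mulrA ler_wpM2r ?HK//.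
  by rewrite invr_ge0 exprn_ge0// ltW.
Qed.
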